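(* Let $N\in\mathbb{N}$, let $0<q<1$ (possibly depending on $N$), let $A$ be an $N\times N$ random matrix with independent Bernoulli$(q)$ entries, and let $\gamma_{sqc}=\max(q,1-q)$ and $\gamma_{qc}=\sqrt{q^2+(1-q)^2}$. Then asymptotically almost surely: (i) If $1\ge 1-\gamma_{sqc}\gg\frac{\log(N)}{N}$, then with $\eta=1+\log_N(\log(1/\gamma_{sqc}))$, $$\mathrm{SQC}(A)\ge(\eta-o(1))\frac{\log(N)}{\log(1/\gamma_{sqc})},\qquad \mathrm{SQCP}(A)\le(1+o(1))\frac{\log(N)}{\log(1/\gamma_{sqc})};$$ (ii) If $\frac{\log(N)}{N}\gg 1-\gamma_{sqc}$, then $\mathrm{SQC}(A)$ is undefined. Moreover, the same statements hold for $\mathrm{QC}(A)$ with $\gamma_{sqc}$ replaced by $\gamma_{qc}$: if $1-\gamma_{qc}\gg\frac{\log N}{N}$ then, with $\eta_{qc}=1+\log_N(\log(1/\gamma_{qc}))$, a.a.s. $(\eta_{qc}-o(1))\frac{\log(N)}{\log(1/\gamma_{qc})}\le\mathrm{QC}(A)\le(1+o(1))\frac{\log(N)}{\log(1/\gamma_{qc})}$, and if $\frac{\log N}{N}\gg 1-\gamma_{qc}$ then $\mathrm{QC}(A)$ is a.a.s. undefined.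
   Context: Rows of $A$ are indexed by $\mathcal{R}=[N]$ (''queries'') and columns by $\mathcal{C}=[N]$ (''targets''); for $R\subseteq\mathcal{R}$, $W\subseteq\mathcal{C}$, $A_{R,W}$ is the submatrix with rows $R$ and columns $W$. $\mathrm{QC}(A)$ (query complexity) is the minimum $|R|$ such that $A_{R,\mathcal{C}}$ has pairwise different columns. Given a target column $v^\star$ and a set of rows $R$, the candidate targets are $\mathcal{T}_R(A)=\{v\in[N]: A_{R,\{v\}}=A_{R,\{v^\star\}}\}$. The sequential query complexity $\mathrm{SQC}(A)$ is the minimum $r\in\mathbb{N}$ for which there is a function $g$ mapping triples $(A,R,A_{R,\{v^\star\}})$ ($R\subseteq\mathcal{R}$, $v^\star\in\mathcal{C}$) to rows in $\mathcal{R}$ such that, setting $R_0=\emptyset$ and $R_{j+1}=R_j\cup\{g(A,R_j,A_{R_j,\{v^\star\}})\}$, one has $|\mathcal{T}_{R_r}(A)|=1$ for every $v^\star\in\mathcal{C}$. $\mathrm{SQCP}(A)$ is defined identically but requiring $g$ to be computable in polynomial time. These quantities are ''undefined'' if no such $R$ / $r$ exists (i.e. $A$ has two identical columns). ''A.a.s.'' (asymptotically almost surely) means with probability tending to $1$ as $N\to\infty$; $f\ll g$ means $f/g\to0$; $\log$ is the natural logarithm and $\log_N x=\log x/\log N$. *)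

(* Defs.v *)
From HB Require Import structures.
From mathcomp Require Import all_boot all_order all_algebra.
From mathcomp Require Import all_classical all_reals all_analysis.

Set Implicit Arguments.
Unset Strict Implicit.
Unset Printing Implicit Defensive.

Import Order.TTheory GRing.Theory Num.Theory.
Import numFieldNormedType.Exports.

Local Open Scope classical_set_scope.
Local Open Scope ring_scope.

(* None stands for "undefined". *)
Definition minimum (P : nat -> Prop) : option nat :=
  match pselect (exists r, `[< P r >]) with
  | left h => Some (ex_minn h)
  | right _ => None
  end.

Section QueryComplexity.
Local Open Scope nat_scope.

(* The submatrix A_{R,{v}}, together with the positions of its rows: the value
   is None exactly outside R. *)
Definition restr_col N (A : 'M[bool]_N) (R : {set 'I_N}) (v : 'I_N) :
    {ffun 'I_N -> option bool} :=
  [ffun i => if i \in R then Some (A i v) else None].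

Definition QC N (A : 'M[bool]_N) : option nat :=
  minimum (fun r => exists R : {set 'I_N}, #|R| = r /\ injective (restr_col A R)).

Definition candidates N (A : 'M[bool]_N) (R : {set 'I_N}) (vstar : 'I_N) :
    {set 'I_N} :=
  [set v | restr_col A R v == restr_col A R vstar]%SET.

(* One strategy handles matrices of every size N = n.+1; N = 0 is excluded since
   there is then no row to query. *)
Definition strategy : Type := forall n : nat,
  'M[bool]_n.+1 -> {set 'I_n.+1} -> {ffun 'I_n.+1 -> option bool} -> 'I_n.+1.

Fixpoint queried (g : strategy) n (A : 'M[bool]_n.+1) (vstar : 'I_n.+1) (j : nat)
    : {set 'I_n.+1} :=
  if j is k.+1 then
    let R := queried g A vstar k in
    (R :|: [set g n A R (restr_col A R vstar)])%SET
  else finset.set0.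

Definition identifies (g : strategy) n (A : 'M[bool]_n.+1) (r : nat) : Prop :=
  forall vstar, #|candidates A (queried g A vstar r) vstar| = 1.

Definition SQC n (A : 'M[bool]_n.+1) : option nat :=
  minimum (fun r => exists g : strategy, identifies g A r).

End QueryComplexity.

(* Polynomial time is formalised with the unit-cost random access machine of
   Cook and Reckhow (registers holding natural numbers; addition and truncated
   subtraction but no multiplication, so that it is polynomially equivalent to
   Turing machines), with random access to a read-only input. *)
Section RandomAccessMachine.
Local Open Scope nat_scope.

Inductive instr :=
  | RConst of nat & nat         (* X_i := c *)
  | RAdd of nat & nat & nat     (* X_i := X_j + X_k *)
  | RSub of nat & nat & nat     (* X_i := X_j - X_k, truncated at 0 *)
  | RLoad of nat & nat          (* X_i := X_(X_j) *)
  | RStore of nat & nat         (* X_(X_i) := X_j *)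
  | RInput of nat & nat         (* X_i := cell number X_j of the input *)
  | RJump of nat & nat.         (* go to instruction l if X_i > 0 *)

Definition ram_state : Type := (nat * (nat -> nat))%type.

Definition upd (X : nat -> nat) (i a : nat) : nat -> nat :=
  fun k => if k == i then a else X k.

Definition ram_step (p : seq instr) (x : seq nat) (s : ram_state) : ram_state :=
  let: (pc, X) := s in
  match onth p pc with
  | None => s
  | Some (RConst i c) => (pc.+1, upd X i c)
  | Some (RAdd i j k) => (pc.+1, upd X i (X j + X k))
  | Some (RSub i j k) => (pc.+1, upd X i (X j - X k))
  | Some (RLoad i j) => (pc.+1, upd X i (X (X j)))
  | Some (RStore i j) => (pc.+1, upd X (X i) (X j))
  | Some (RInput i j) => (pc.+1, upd X i (nth 0 x (X j)))
  | Some (RJump i l) => (if 0 < X i then l else pc.+1, X)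
  end.

(* The machine halts when the program counter leaves the program; the output is
   then the content of X_0. *)
Definition ram_outputs (p : seq instr) (x : seq nat) (t y : nat) : Prop :=
  let s := iter t (ram_step p x) (0, fun=> 0) in
  size p <= s.1 /\ s.2 0 = y.

(* N, the entries of A row by row, the indicator of R, and the observed entries
   (0 outside R); the length is N ^ 2 + 2 * N + 1. *)
Definition encode n (A : 'M[bool]_n.+1) (R : {set 'I_n.+1})
    (y : {ffun 'I_n.+1 -> option bool}) : seq nat :=
  n.+1 :: [seq nat_of_bool (A i j) | i <- enum 'I_n.+1, j <- enum 'I_n.+1]
       ++ [seq nat_of_bool (i \in R) | i <- enum 'I_n.+1]
       ++ [seq nat_of_bool (y i == Some true) | i <- enum 'I_n.+1].

Definition polynomial_time (g : strategy) : Prop :=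
  exists (p : seq instr) (c : nat),
    forall n (A : 'M[bool]_n.+1) (R : {set 'I_n.+1}) (vstar : 'I_n.+1),
      let y := restr_col A R vstar in
      exists2 t, t <= c * n.+1 ^ c & ram_outputs p (encode A R y) t (g n A R y).

(* The number of queries used by one fixed strategy. *)
Definition SQC_by (g : strategy) n (A : 'M[bool]_n.+1) : option nat :=
  minimum (identifies g A).

(* Minimising over polynomial-time strategies for each matrix separately puts no
   uniformity constraint on the choice of the strategy as the matrix varies;
   [SQC_by g] with one polynomial-time g for all matrices expresses it. *)
Definition SQCP n (A : 'M[bool]_n.+1) : option nat :=
  minimum (fun r => exists g : strategy, polynomial_time g /\ identifies g A r).

End RandomAccessMachine.

Section Asymptotics.
Variable R : realType.
Implicit Types (q f g gamma : nat -> R).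

(* The probability of E for an N x N matrix of independent Bernoulli(q) entries. *)
Definition random_matrix_prob N (q : R) (E : 'M[bool]_N -> Prop) : R :=
  \sum_(A : 'M[bool]_N | `[< E A >])
    \prod_(i < N) \prod_(j < N) (if A i j then q else 1 - q).

(* The matrix size is N = n.+1. *)
Definition aas q (E : forall n, 'M[bool]_n.+1 -> Prop) : Prop :=
  random_matrix_prob (q n.+1) (@E n) @[n --> \oo] --> (1 : R).

Definition much_less f g : Prop := f N / g N @[N --> \oo] --> (0 : R).

Definition little_o1 (e : nat -> R) : Prop := e N @[N --> \oo] --> (0 : R).

Definition logN_over_N (N : nat) : R := ln N%:R / N%:R.

Definition gamma_sqc q (N : nat) : R := Num.max (q N) (1 - q N).

Definition gamma_qc q (N : nat) : R := Num.sqrt (q N ^+ 2 + (1 - q N) ^+ 2).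

Definition query_rate gamma (N : nat) : R := ln N%:R / ln (1 / gamma N).

Definition eta_exp gamma (N : nat) : R := 1 + ln (ln (1 / gamma N)) / ln N%:R.

End Asymptotics.

(* Main.v *)
Require Import Defs.
From mathcomp Require Import all_boot all_order all_algebra.
From mathcomp Require Import all_classical all_reals all_analysis.
From mathcomp Require Import zify ring lra.

(** A strategy that has received the majority answer to all of its at most r
    queries cannot distinguish the columns that are constant on the queried
    rows. For a fixed set of r rows about N gamma^r columns are constant, and for
    r below the stated rate this number is so large (N^eps / ln (1 / gamma)) that
    a union bound over all sets of r rows shows that two such columns always
    exist; with all rows queried it shows that two columns of the matrix are
    equal in case (ii). For QC, constant columns are replaced by a birthday
    estimate: n samples from a law p on a finite set are all distinct with
    probability n! e_n(p), which is at most about exp (- n (sum p^2)^(1/2) / 8).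

    For the upper bound on SQC, query a row that splits the current candidates
    most evenly. By Chernoff's inequality and a union bound over sets D of columns,
    whenever |D| >= K := eps ln N / (1 - gamma) some row leaves, for both answers,
    at most a fraction gamma^(1 - 2 eps) of D. Below K candidates it is enough
    that every query separates two candidates, since K is only O(eps) times the
    rate. The upper bound on QC is a union bound over pairs of columns, for any set
    of rows of the right size. *)

Set Implicit Arguments.
Unset Strict Implicit.
Unset Printing Implicit Defensive.

Import Order.TTheory GRing.Theory Num.Theory.
Import numFieldNormedType.Exports.
Local Open Scope ring_scope.

(** * Programs for the random access machine *)

Arguments ram_step : simpl never.

Section StructuredPrograms.
Local Open Scope nat_scope.
Variable x : seq nat.
Implicit Types (X Y Z : nat -> nat) (P Q : (nat -> nat) -> Prop).

Definition effect X (c : instr) : nat -> nat :=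
  match c with
  | RConst i a => upd X i a
  | RAdd i j k => upd X i (X j + X k)
  | RSub i j k => upd X i (X j - X k)
  | RLoad i j => upd X i (X (X j))
  | RStore i j => upd X (X i) (X j)
  | RInput i j => upd X i (nth 0 x (X j))
  | RJump _ _ => X
  end.

Definition is_jump (c : instr) : bool := if c is RJump _ _ then true else false.

(* [Repeat r c] runs c until X_r = 0, at least once; [Unless r c] runs c if
   X_r = 0. *)
Inductive code :=
  | Block of seq instr
  | Seq of code & code
  | Repeat of nat & code
  | Unless of nat & code.

Fixpoint code_size (c : code) : nat :=
  match c with
  | Block s => size s
  | Seq c d => code_size c + code_size d
  | Repeat _ c => (code_size c).+1
  | Unless _ c => (code_size c).+1
  end.

Fixpoint compile (start : nat) (c : code) : seq instr :=
  match c with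
  | Block s => s
  | Seq c d => compile start c ++ compile (start + code_size c) d
  | Repeat r c => rcons (compile start c) (RJump r start)
  | Unless r c => RJump r (start + (code_size c).+1) :: compile start.+1 c
  end.

Lemma size_compile start c : size (compile start c) = code_size c.
Proof.
elim: c start => //= [c IHc d IHd|r c IH|r c IH] start.
- by rewrite size_cat IHc IHd.
- by rewrite size_rcons IH.
- by rewrite IH.
Qed.

Definition runs (c : code) X (t : nat) Y : Prop :=
  forall before after,
    iter t (ram_step (before ++ compile (size before) c ++ after) x) (size before, X)
    = (size before + code_size c, Y).

Lemma onth_cat_size (s1 : seq instr) i s2 : onth (s1 ++ i :: s2) (size s1) = Some i.
Proof. by rewrite onthE map_cat nth_cat size_map ltnn subnn. Qed.

Lemma runs_block s X : all (predC is_jump) s ->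
  runs (Block s) X (size s) (foldl effect X s).
Proof.
elim: s X => [|i s IH] X /= => [_ before after|/andP[ni /IH{}IH] before after].
  by rewrite addn0.
rewrite -[LHS]/(iter (size s).+1 _ _) iterSr.
have -> : ram_step (before ++ (i :: s) ++ after) x (size before, X)
          = ((size before).+1, effect X i).
  by rewrite /ram_step cat_cons onth_cat_size; case: i ni.
have := IH (effect X i) (rcons before i) after.
by rewrite size_rcons /= cat_rcons => ->; rewrite addSnnS.
Qed.

Lemma runs_seq c d X t Y u Z :
  runs c X t Y -> runs d Y u Z -> runs (Seq c d) X (u + t) Z.
Proof.
move=> run_c run_d before after /=; rewrite iterD -catA run_c.
have := run_d (before ++ compile (size before) c) after.
by rewrite -catA size_cat size_compile => ->; rewrite addnA.
Qed.

Lemma ram_step_jump before after r l X :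
  ram_step (before ++ RJump r l :: after) x (size before, X)
  = (if 0 < X r then l else (size before).+1, X).
Proof. by rewrite /ram_step onth_cat_size. Qed.

Lemma runs_repeat_jump r c X t Y before after : runs c X t Y ->
  iter t.+1 (ram_step (before ++ compile (size before) (Repeat r c) ++ after) x)
    (size before, X)
  = (if 0 < Y r then size before else size before + code_size (Repeat r c), Y).
Proof.
move=> run_c; rewrite iterS /= cat_rcons run_c.
have := ram_step_jump (before ++ compile (size before) c) after r (size before) Y.
by rewrite -catA size_cat size_compile addnS.
Qed.

Definition hoare P (c : code) (tmax : nat) Q : Prop :=
  forall X, P X -> exists t Y, [/\ t <= tmax, runs c X t Y & Q Y].

Lemma hoare_consequence P P' c t t' Q Q' : (forall X, P' X -> P X) -> t <= t' ->
  (forall X, Q X -> Q' X) -> hoare P c t Q -> hoare P' c t' Q'.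
Proof.
move=> PP tt QQ triple X /PP/triple[u [Y [ut run_c QY]]]; exists u, Y; split=> //.
  exact: leq_trans tt.
exact: QQ.
Qed.

Lemma hoare_block P s Q : all (predC is_jump) s ->
  (forall X, P X -> Q (foldl effect X s)) -> hoare P (Block s) (size s) Q.
Proof.
move=> no_jump PQ X PX; exists (size s), (foldl effect X s).
by split=> //; [exact: runs_block|exact: PQ].
Qed.

Lemma hoare_seq P Q S c d t u :
  hoare P c t Q -> hoare Q d u S -> hoare P (Seq c d) (t + u) S.
Proof.
move=> triple_c triple_d X /triple_c[tc [Y [tct run_c]]].
move=> /triple_d[td [Z [tdu run_d SZ]]].
exists (td + tc), Z; split=> //; first by rewrite addnC leq_add.
exact: runs_seq run_c run_d.
Qed.

Lemma hoare_unless P Q r c t :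
  (forall X, P X -> 0 < X r -> Q X) ->
  hoare (fun X => P X /\ X r = 0) c t Q -> hoare P (Unless r c) t.+1 Q.
Proof.
move=> PQ triple_c X PX; have [Xr|] := ltnP 0 (X r).
  exists 1, X; split=> //; last exact: PQ.
  by move=> before after /=; rewrite ram_step_jump Xr.
rewrite leqn0 => /eqP Xr; have [u [Y [ut run_c QY]]] := triple_c X (conj PX Xr).
exists u.+1, Y; split=> // before after /=.
rewrite -[LHS]/(iter u.+1 _ _) iterSr ram_step_jump Xr ltnn.
have := run_c (rcons before (RJump r (size before + (code_size c).+1))) after.
by rewrite size_rcons cat_rcons => ->; rewrite addSnnS.
Qed.

Lemma hoare_repeat (Inv : nat -> (nat -> nat) -> Prop) r c m t : 0 < m ->
  (forall j, j < m ->
     hoare (Inv j) c t (fun X => Inv j.+1 X /\ X r = m - j.+1)) ->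
  hoare (Inv 0) (Repeat r c) (m * t.+1) (Inv m).
Proof.
move=> m0 triple_c.
suff remaining d j : j + d.+1 = m -> hoare (Inv j) (Repeat r c) (d.+1 * t.+1) (Inv m).
  by case: m m0 {triple_c} remaining => // m _ remaining; apply: remaining.
elim: d j => [|d IH] j jm X IX;
    have [|u [Y [ut run_c [IY Yr]]]] := triple_c j _ X IX; try by lia.
  exists u.+1, Y; split; rewrite ?mul1n //; last by rewrite -jm addn1.
  by move=> before after; rewrite (runs_repeat_jump _ _ _ run_c) Yr ifF //; lia.
have [|w [Z [wt run_rest IZ]]] := IH j.+1 _ Y IY; first by lia.
exists (w + u.+1), Z; split=> //; first by rewrite mulSn; lia.
move=> before after; rewrite iterD (runs_repeat_jump _ _ _ run_c) ifT ?run_rest //.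
by lia.
Qed.

Lemma runs_outputs c t Y : runs c (fun=> 0) t Y ->
  ram_outputs (compile 0 c) x t (Y 0).
Proof.
move=> /(_ [::] [::]); rewrite /= cats0 add0n /ram_outputs => ->.
by rewrite size_compile.
Qed.

End StructuredPrograms.

Section SymbolicExecution.
Local Open Scope nat_scope.
Variable x : seq nat.
Implicit Types (e : seq (nat * nat)) (X : nat -> nat).

Fixpoint lookup e r : option nat :=
  if e is (k, a) :: e' then if eqn r k then Some a else lookup e' r else None.

Definition holds e X : Prop := forall r a, lookup e r = Some a -> X r = a.

Definition lookup2 e j k (op : nat -> nat -> nat) : option nat :=
  if lookup e j is Some a then if lookup e k is Some b then Some (op a b) else None
  else None.

Definition symbolic_step (oe : option (seq (nat * nat))) (c : instr) :=
  if oe is Some e then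
    match c with
    | RConst i a => Some ((i, a) :: e)
    | RAdd i j k => if lookup2 e j k addn is Some a then Some ((i, a) :: e) else None
    | RSub i j k => if lookup2 e j k subn is Some a then Some ((i, a) :: e) else None
    | RInput i j =>
        if lookup e j is Some a then Some ((i, nth 0 x a) :: e) else None
    | _ => None
    end
  else None.

Definition symbolic_run e (s : seq instr) := foldl symbolic_step (Some e) s.

Lemma holds_upd e X i a : holds e X -> holds ((i, a) :: e) (upd X i a).
Proof.
move=> eX r b; rewrite /= /upd -/(eqn r i) eqnE; case: eqP => [_ [->]//|_].
exact: eX.
Qed.

Lemma lookup2_holds e X j k op a : holds e X -> lookup2 e j k op = Some a ->
  a = op (X j) (X k).
Proof.
rewrite /lookup2 => eX.
case ej: (lookup e j) => [u|//]; case ek: (lookup e k) => [w|//] [<-].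
by rewrite (eX _ _ ej) (eX _ _ ek).
Qed.

Lemma symbolic_step_holds e X c e' : holds e X -> symbolic_step (Some e) c = Some e' ->
  holds e' (effect x X c).
Proof.
case: c => //= [i a|i j k|i j k|i j] eX.
- by case=> <-; exact: holds_upd.
- case val: lookup2 => [b|//] [<-]; rewrite -(lookup2_holds eX val).
  exact: holds_upd.
- case val: lookup2 => [b|//] [<-]; rewrite -(lookup2_holds eX val).
  exact: holds_upd.
- by case val: lookup => [b|//] [<-]; rewrite (eX _ _ val); exact: holds_upd.
Qed.

Lemma symbolic_step_not_jump e c e' :
  symbolic_step (Some e) c = Some e' -> ~~ is_jump c.
Proof. by case: c. Qed.

Lemma symbolic_run_hoare e s e' : symbolic_run e s = Some e' ->
  hoare x (holds e) (Block s) (size s) (holds e').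
Proof.
have stuck u : foldl symbolic_step None u = None by elim: u.
move=> run; suff [no_jump e_e'] : all (predC is_jump) s /\
    forall X, holds e X -> holds e' (foldl (effect x) X s) by exact: hoare_block.
elim: s e run => [|c s IH] e; first by case=> <-.
rewrite /symbolic_run -[foldl _ _ _]/(foldl symbolic_step (symbolic_step (Some e) c) s).
case step: (symbolic_step (Some e) c) => [e1|]; last by rewrite stuck.
rewrite -/(symbolic_run e1 s) => /IH[no_jump e1_e']; split.
  by rewrite /= (symbolic_step_not_jump step).
by move=> X eX; apply: e1_e'; exact: symbolic_step_holds eX step.
Qed.

Fixpoint subenv e e' : Prop :=
  if e is (r, a) :: f then lookup e' r = Some a /\ subenv f e' else True.

Lemma subenv_holds e e' X : subenv e e' -> holds e' X -> holds e X.
Proof.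
move=> ee' e'X r a; elim: e ee' => //= -[k b] e IH [e'k /IH{}IH].
rewrite eqnE; case: eqP => [-> [<-]|_ //]; exact: e'X.
Qed.

Lemma hoare_symbolic e s e' :
  (if symbolic_run e s is Some e1 then subenv e' e1 else False) ->
  hoare x (holds e) (Block s) (size s) (holds e').
Proof.
case run: (symbolic_run e s) => [e1|//] e'_e1.
apply: hoare_consequence (leqnn _) _ (symbolic_run_hoare run) => // X.
exact: subenv_holds.
Qed.

Lemma hoare_repeat_symbolic (Inv : nat -> seq (nat * nat)) r c m t : 0 < m ->
  (forall j, lookup (Inv j) r = Some (m - j)) ->
  (forall j, j < m -> hoare x (holds (Inv j)) c t (holds (Inv j.+1))) ->
  hoare x (holds (Inv 0)) (Repeat r c) (m * t.+1) (holds (Inv m)).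
Proof.
move=> m0 counter triple_c.
apply: (hoare_repeat (Inv := fun j => holds (Inv j))) => // j jm.
apply: hoare_consequence (leqnn _) _ (triple_c j jm) => // X IX; split=> //.
exact: IX (counter _).
Qed.

End SymbolicExecution.

Section GreedyProgram.
Local Open Scope nat_scope.

(* [r_rows], [r_cols], [r_cells] count the remaining iterations of the loops over
   the rows i, the columns v, and the rows k against which v is tested; [r_Ai0],
   [r_Aiv], [r_A0v], [r_Akv], [r_Rk], [r_yk] are addresses of input cells, and
   [r_R] is the address of the indicator of R. *)
Local Notation r_best := 0.
Local Notation r_N := 1.
Local Notation r_one := 2.
Local Notation r_R := 3.
Local Notation r_rows := 4.
Local Notation r_row := 5.
Local Notation r_Ai0 := 6.
Local Notation r_score := 7.
Local Notation r_cols := 8.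
Local Notation r_Aiv := 9.
Local Notation r_A0v := 10.
Local Notation r_ones := 11.
Local Notation r_zeros := 12.
Local Notation r_cells := 13.
Local Notation r_Akv := 14.
Local Notation r_Rk := 15.
Local Notation r_yk := 16.
Local Notation r_mismatches := 17.
Local Notation r_zero := 18.
Local Notation r_tmp1 := 19.
Local Notation r_tmp2 := 20.
Local Notation r_tmp3 := 21.
Local Notation r_tmp4 := 22.

Definition test_cell := Block
  [:: RInput r_tmp1 r_Akv; RInput r_tmp2 r_yk;
      RSub r_tmp3 r_tmp1 r_tmp2; RSub r_tmp4 r_tmp2 r_tmp1; RAdd r_tmp3 r_tmp3 r_tmp4;
      RInput r_tmp1 r_Rk; RSub r_tmp1 r_one r_tmp1; RSub r_tmp3 r_tmp3 r_tmp1;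
      RAdd r_mismatches r_mismatches r_tmp3;
      RAdd r_Akv r_Akv r_N; RAdd r_Rk r_Rk r_one; RAdd r_yk r_yk r_one;
      RSub r_cells r_cells r_one].

Definition test_column :=
  Seq (Block [:: RAdd r_cells r_N r_zero; RAdd r_Akv r_A0v r_zero;
                 RAdd r_Rk r_R r_zero; RAdd r_yk r_R r_N; RConst r_mismatches 0])
  (Seq (Repeat r_cells test_cell)
  (Block [:: RSub r_mismatches r_one r_mismatches; RInput r_tmp1 r_Aiv;
             RAdd r_tmp2 r_mismatches r_tmp1; RSub r_tmp2 r_tmp2 r_one;
             RAdd r_ones r_ones r_tmp2;
             RSub r_tmp2 r_mismatches r_tmp1; RAdd r_zeros r_zeros r_tmp2;
             RAdd r_Aiv r_Aiv r_one; RAdd r_A0v r_A0v r_one;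
             RSub r_cols r_cols r_one])).

Definition keep_best :=
  Unless r_tmp2 (Block [:: RAdd r_score r_tmp1 r_zero; RAdd r_best r_row r_zero]).

Definition score_row :=
  Seq (Block [:: RAdd r_cols r_N r_zero; RAdd r_Aiv r_Ai0 r_zero; RConst r_A0v 1;
                 RConst r_ones 0; RConst r_zeros 0])
  (Seq (Repeat r_cols test_column)
  (Seq (Block [:: RSub r_tmp1 r_ones r_zeros; RSub r_tmp1 r_ones r_tmp1;
                  RAdd r_tmp2 r_score r_one; RSub r_tmp2 r_tmp2 r_tmp1])
  (Seq keep_best
  (Block [:: RAdd r_row r_row r_one; RAdd r_Ai0 r_Ai0 r_N;
             RSub r_rows r_rows r_one])))).

Definition greedy_code :=
  Seq (Block [:: RInput r_N r_zero; RConst r_one 1; RConst r_R 1;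
                 RAdd r_rows r_N r_zero])
  (Seq (Repeat r_rows (Block [:: RAdd r_R r_R r_N; RSub r_rows r_rows r_one]))
  (Seq (Block [:: RAdd r_rows r_N r_zero; RConst r_row 0; RConst r_Ai0 1;
                  RConst r_score 0])
  (Repeat r_rows score_row))).

Variables (x : seq nat) (N : nat).
Local Notation entry k v := (nth 0 x (1 + k * N + v)).
Local Notation asked k := (nth 0 x (1 + N * N + k)).
Local Notation answer k := (nth 0 x (1 + N * N + N + k)).

(* All cells are 0 or 1, so the truncated differences below compute Boolean
   combinations: here, whether row k was asked and A k v differs from the answer. *)
Definition mismatches_upto j v :=
  \sum_(0 <= k < j) ((entry k v - answer k) + (answer k - entry k v) - (1 - asked k)).

Definition alive v := 1 - mismatches_upto N v.

Definition ones_upto j i := \sum_(0 <= v < j) (alive v + entry i v - 1).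

Definition zeros_upto j i := \sum_(0 <= v < j) (alive v - entry i v).

Definition row_score i := minn (ones_upto N i) (zeros_upto N i).

Fixpoint best_upto j : nat * nat :=
  if j is i.+1 then
    if (best_upto i).2 < row_score i then (i, row_score i) else best_upto i
  else (0, 0).

Hypotheses (N_gt0 : 0 < N) (x_size : nth 0 x 0 = N).

Definition global_regs := [:: (r_N, N); (r_one, 1); (r_R, 1 + N * N); (r_zero, 0)].

Definition row_regs i (best : nat * nat) := global_regs ++
  [:: (r_rows, N - i); (r_row, i); (r_Ai0, 1 + i * N); (r_score, best.2);
      (r_best, best.1)].

Definition col_regs i v := row_regs i (best_upto i) ++
  [:: (r_cols, N - v); (r_Aiv, 1 + i * N + v); (r_A0v, 1 + v);
      (r_ones, ones_upto v i); (r_zeros, zeros_upto v i)].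

Definition cell_regs i v k := col_regs i v ++
  [:: (r_cells, N - k); (r_Akv, 1 + k * N + v); (r_Rk, 1 + N * N + k);
      (r_yk, 1 + N * N + N + k); (r_mismatches, mismatches_upto k v)].

Definition scored_regs i := row_regs i (best_upto i) ++
  [:: (r_tmp1, row_score i); (r_tmp2, (best_upto i).2 + 1 - row_score i)].

Ltac symbolic_execution :=
  apply: hoare_symbolic;
  cbv [symbolic_run symbolic_step lookup lookup2 foldl subenv cat global_regs
       row_regs col_regs cell_regs scored_regs eqn];
  do !split; congr Some.

Lemma hoare_test_cell i v k : k < N ->
  hoare x (holds (cell_regs i v k)) test_cell 13 (holds (cell_regs i v k.+1)).
Proof.
move=> kN; have mismatchesS : mismatches_upto k.+1 v = mismatches_upto k v
    + ((entry k v - answer k) + (answer k - entry k v) - (1 - asked k)).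
  by rewrite /mismatches_upto big_nat_recr.
symbolic_execution; rewrite ?mismatchesS; lia.
Qed.

Lemma hoare_test_column i v : v < N ->
  hoare x (holds (col_regs i v)) test_column (15 + N * 14)
    (holds (col_regs i v.+1)).
Proof.
move=> vN; rewrite (_ : 15 + N * 14 = 5 + (N * 14 + 10)); last by lia.
have mismatches0 : mismatches_upto 0 v = 0 by rewrite /mismatches_upto big_nil.
have onesS : ones_upto v.+1 i = ones_upto v i + (alive v + entry i v - 1).
  by rewrite /ones_upto big_nat_recr.
have zerosS : zeros_upto v.+1 i = zeros_upto v i + (alive v - entry i v).
  by rewrite /zeros_upto big_nat_recr.
apply: (@hoare_seq _ _ (holds (cell_regs i v 0))).
  by symbolic_execution; rewrite ?mismatches0; lia.
apply: hoare_seq.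
  apply: (@hoare_repeat_symbolic x (fun k => cell_regs i v k) r_cells _ N) => // k kN.
  exact: hoare_test_cell.
by symbolic_execution; rewrite ?onesS ?zerosS /alive; lia.
Qed.

Lemma hoare_keep_best i :
  hoare x (holds (scored_regs i)) keep_best 3 (holds (row_regs i (best_upto i.+1))).
Proof.
apply: hoare_unless => [X regs|].
  rewrite (regs r_tmp2 _ erefl) subn_gt0 addn1 ltnS => score_le.
  by apply: subenv_holds regs; rewrite /row_regs /= ltnNge score_le; do !split.
have [best_lt|score_le] := ltnP (best_upto i).2 (row_score i); last first.
  by move=> X [regs]; rewrite (regs r_tmp2 _ erefl); lia.
apply: (hoare_consequence (P := holds (scored_regs i)) _ (leqnn 2) (fun=> id)).
  by move=> X [].
by rewrite /row_regs /= best_lt; symbolic_execution; rewrite /= addn0.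
Qed.

Lemma hoare_score_row i : i < N ->
  hoare x (holds (row_regs i (best_upto i))) score_row (15 + N * (16 + N * 14))
    (holds (row_regs i.+1 (best_upto i.+1))).
Proof.
move=> iN.
rewrite (_ : 15 + _ = 5 + (N * (15 + N * 14).+1 + (4 + (3 + 3)))); last by lia.
have ones0 : ones_upto 0 i = 0 by rewrite /ones_upto big_nil.
have zeros0 : zeros_upto 0 i = 0 by rewrite /zeros_upto big_nil.
apply: (@hoare_seq _ _ (holds (col_regs i 0))).
  by symbolic_execution; rewrite ?ones0 ?zeros0; lia.
apply: hoare_seq.
  apply: (@hoare_repeat_symbolic x (fun v => col_regs i v) r_cols _ N) => // v vN.
  exact: hoare_test_column.
apply: (@hoare_seq _ _ (holds (scored_regs i))).
  by symbolic_execution; rewrite /row_score; lia.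
apply: (hoare_seq (@hoare_keep_best i)).
by symbolic_execution; lia.
Qed.

Lemma hoare_greedy_code :
  hoare x (fun X => forall r, X r = 0) greedy_code
    (4 + (N * 3 + (4 + N * (15 + N * (16 + N * 14)).+1)))
    (holds (row_regs N (best_upto N))).
Proof.
pose start_regs := [:: (r_best, 0); (r_zero, 0)].
pose square_regs j := [:: (r_best, 0); (r_N, N); (r_one, 1); (r_R, 1 + j * N);
  (r_zero, 0); (r_rows, N - j)].
apply: (hoare_consequence (P := holds start_regs) _ (leqnn _) (fun=> id)).
  by move=> X X0 r a /=; do 2 (case: eqn => [[<-]//|]).
apply: (@hoare_seq _ _ (holds (square_regs 0))).
  by rewrite /start_regs /square_regs; symbolic_execution; rewrite ?x_size; lia.
apply: hoare_seq.
  apply: (@hoare_repeat_symbolic x square_regs r_rows _ N) => // j jN.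
  by rewrite /square_regs; symbolic_execution; lia.
apply: (@hoare_seq _ _ (holds (row_regs 0 (best_upto 0)))).
  by rewrite /square_regs; symbolic_execution => //=; lia.
apply: (@hoare_repeat_symbolic x (fun i => row_regs i (best_upto i)) r_rows _ N) => //.
exact: hoare_score_row.
Qed.

Lemma greedy_code_outputs : exists2 t, t <= 100 * N ^ 100 &
  ram_outputs (compile 0 greedy_code) x t (best_upto N).1.
Proof.
have [//|t [X [t_le run regs]]] := hoare_greedy_code (X := fun=> 0).
exists t; last by rewrite -(regs r_best _ erefl); exact: runs_outputs.
apply: (leq_trans t_le); apply: (@leq_trans (100 * N ^ 3)); last first.
  by rewrite leq_mul2l leq_pexp2l.
rewrite !expnS expn0; nia.
Qed.

End GreedyProgram.

(** * Elementary inequalities *)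

Section Inequalities.
Variable R : realType.

Lemma sqrtrX (x : R) n : 0 <= x -> Num.sqrt (x ^+ n) = Num.sqrt x ^+ n.
Proof.
move=> x_ge0; elim: n => [|n IH]; first by rewrite sqrtr1.
by rewrite !exprS sqrtrM // IH.
Qed.

Lemma expR_ln_natS n : expR (ln n.+1%:R) = n.+1%:R :> R.
Proof. by rewrite lnK // posrE. Qed.

Lemma ln_natS_gt0 n : (0 < ln n.+1%:R :> R) = (0 < n)%N.
Proof. by case: n => [|n]; rewrite ?ln1 ?ltxx // ln_gt0 // ltr1n. Qed.

Lemma powR_natSE n (a : R) : n.+1%:R `^ a = expR (a * ln n.+1%:R).
Proof. by rewrite -{1}(expR_ln_natS n) -expRM mulrC. Qed.

Lemma expR_neg_le (s : R) : 0 <= s -> expR (- s) <= 1 - s + s ^+ 2.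
Proof.
move=> s_ge0; rewrite expRN -div1r ler_pdivrMr ?expR_gt0 //.
have := expR_ge1Dx s; have : 0 <= s ^+ 3 by rewrite exprn_ge0.
have : 0 <= 1 - s + s ^+ 2 by nra.
nra.
Qed.

(* ln (1 + x) = 2 ln s <= 2 (s - 1) with s := sqrt (1 + x). *)
Lemma oneD_le_expR (x : R) : 0 <= x ->
  1 + x <= expR (x - x ^+ 2 / (4 * (1 + x))).
Proof.
move=> x_ge0; pose s := Num.sqrt (1 + x).
have sqr_sE : s ^+ 2 = 1 + x by rewrite sqr_sqrtr //; lra.
have s_ge0 : 0 <= s by exact: sqrtr_ge0.
have s_ge1 : 1 <= s by nra.
rewrite -{1}sqr_sE; apply: (@le_trans _ _ (expR (2%:R * (s - 1)))).
  rewrite expRM_natl; apply: lerXn2r; rewrite ?nnegrE ?expR_ge0 //.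
  by apply: le_trans (expR_ge1Dx _); lra.
rewrite ler_expR -sqr_sE; have -> : x = s ^+ 2 - 1 by lra.
have -> : (s ^+ 2 - 1) ^+ 2 / (4 * s ^+ 2) = (s - 1) ^+ 2 * (((s + 1) / (2 * s)) ^+ 2).
  by field; lra.
have : ((s + 1) / (2 * s)) ^+ 2 <= 1.
  rewrite expr_le1 //; last by rewrite divr_ge0; lra.
  by rewrite ler_pdivrMr; lra.
have := sqr_ge0 (s - 1); nra.
Qed.

Lemma onemX_le_expR (x : R) n : 0 <= x <= 1 ->
  (1 - x) ^+ n <= expR (- (n%:R * x)).
Proof.
move=> /andP[x_ge0 x_le1]; rewrite -mulrN expRM_natl.
by rewrite lerXn2r ?nnegrE ?expR_ge0 ?subr_ge0 ?expR_ge1Dx.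
Qed.

Lemma fact_mul_expR_le n : (0 < n)%N ->
  n`!%:R * expR n%:R <= expR 1 * n%:R ^+ n.+1 :> R.
Proof.
elim: n => // -[_ _|n IH _]; first by rewrite expr1n mul1r mulr1.
have ratio_le : n.+1%:R / n.+2%:R <= expR (- n.+2%:R^-1) :> R.
  apply: le_trans (expR_ge1Dx _).
  by rewrite ler_pdivrMr // mulrBl mulVf // mul1r -[n.+2%:R]natr1 addrK.
have power_le : expR 1 * n.+1%:R ^+ n.+2 <= n.+2%:R ^+ n.+2 :> R.
  rewrite -ler_pdivlMl ?expR_gt0 // -expRN [leRHS]mulrC -ler_pdivrMl ?exprn_gt0 //.
  rewrite mulrC -expr_div_n.
  have -> : expR (- 1) = expR (- n.+2%:R^-1) ^+ n.+2 :> R.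
    by rewrite -expRM_natl mulrN divff.
  by apply: lerXn2r ratio_le; rewrite nnegrE ?expR_ge0 ?divr_ge0.
have -> : n.+2`!%:R * expR n.+2%:R
    = n.+2%:R * expR 1 * (n.+1`!%:R * expR n.+1%:R) :> R.
  by rewrite factS natrM -[in expR _%:R]natr1 expRD; ring.
rewrite exprS [leRHS]mulrCA [leRHS]mulrA.
rewrite ler_wpM2l ?mulr_ge0 ?expR_ge0 //.
by apply: le_trans power_le; exact: IH.
Qed.

Lemma sum_exp_card (T : finType) (x : R) :
  \sum_(D : {set T}) x ^+ #|D| = (1 + x) ^+ #|T|.
Proof.
rewrite -[X in _ ^+ X]/(#|[pred _ : T | true]|) -prodr_const addrC.
rewrite (bigA_distr _ _ (fun=> x) (fun=> 1)); apply: eq_bigr => D _.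
by rewrite -prodr_const big_mkcond.
Qed.

Lemma sum_nonempty_exp_card_le (T : finType) (x : R) : 0 <= x -> #|T|%:R * x <= 2^-1 ->
  \sum_(D : {set T} | D != finset.set0) x ^+ #|D| <= 2 * (#|T|%:R * x).
Proof.
move=> x_ge0; set y := #|T|%:R * x => y_le; have y_ge0 : 0 <= y by rewrite mulr_ge0.
have -> : \sum_(D : {set T} | D != finset.set0) x ^+ #|D| = (1 + x) ^+ #|T| - 1.
  rewrite -sum_exp_card [in RHS](bigD1 (finset.set0 : {set T})) //=.
  by rewrite cards0 expr0 addrC addrK.
have pow_le : (1 + x) ^+ #|T| <= expR y.
  by rewrite expRM_natl lerXn2r ?nnegrE ?expR_ge0 ?expR_ge1Dx ?addr_ge0.
have : expR y * (1 - y) <= 1.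
  by have := ler_wpM2l (expR_ge0 y) (expR_ge1Dx (- y)); rewrite -expRD subrr expR0.
have : 0 <= (expR y - 1) * (2^-1 - y).
  by rewrite mulr_ge0 ?subr_ge0 // (le_trans _ (expR_ge1Dx y)) // lerDl.
lra.
Qed.

End Inequalities.

(** * Laws on finite types *)

Section FiniteLaws.
Variable R : numDomainType.
Implicit Types I T U : finType.

Definition is_law T (p : T -> R) : Prop := (forall t, 0 <= p t) /\ \sum_t p t = 1.

Definition expect T (p : T -> R) (F : T -> R) : R := \sum_t F t * p t.

Definition Pr T (p : T -> R) (E : T -> Prop) : R := \sum_(t | `[< E t >]) p t.

Definition push T U (h : T -> U) (p : T -> R) (u : U) : R := Pr p (fun t => h t = u).

Definition collision_prob T (p : T -> R) : R := \sum_x p x ^+ 2.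

Definition prod_law I T (p : I -> T -> R) (f : {ffun I -> T}) : R := \prod_i p i (f i).

Lemma PrE T (p : T -> R) E : Pr p E = expect p (fun t => (`[< E t >])%:R).
Proof.
by rewrite /Pr big_mkcond; apply: eq_bigr => t _; case: asbool; rewrite ?mul1r ?mul0r.
Qed.

Lemma eq_Pr T (p : T -> R) (E F : T -> Prop) :
  (forall t, E t <-> F t) -> Pr p E = Pr p F.
Proof. by move=> EF; apply: eq_bigl => t; apply/asbool_equiv_eq. Qed.

Lemma eq_law_Pr T (p p' : T -> R) E : p =1 p' -> Pr p E = Pr p' E.
Proof. by move=> pp'; apply: eq_bigr. Qed.

Lemma Pr_eq T (p : T -> R) x : Pr p (fun t => t = x) = p x.
Proof. by rewrite /Pr (eq_bigl (pred1 x)) ?big_pred1_eq // => t; apply/asboolP/eqP. Qed.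

Lemma expect_push T U (h : T -> U) (p : T -> R) F :
  expect (push h p) F = expect p (fun t => F (h t)).
Proof.
rewrite [RHS](partition_big h xpredT) //; apply: eq_bigr => u _.
rewrite big_distrr; apply: eq_big => t; first exact/asboolP/eqP.
by move=> /asboolP <-.
Qed.

Lemma Pr_push T U (h : T -> U) (p : T -> R) E :
  Pr (push h p) E = Pr p (fun t => E (h t)).
Proof. by rewrite !PrE expect_push. Qed.

Lemma push_inj T U (h : T -> U) (p : T -> R) t : injective h -> push h p (h t) = p t.
Proof. by move=> injh; rewrite -[RHS]Pr_eq; apply: eq_Pr => s; split=> [/injh|->]. Qed.

Lemma collision_prob_push_inj T U (h : T -> U) (p : T -> R) : injective h ->
  collision_prob (push h p) = collision_prob p.
Proof.
move=> injh; transitivity (expect (push h p) (push h p)) => //.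
by rewrite expect_push; apply: eq_bigr => t _; rewrite push_inj.
Qed.

Section OneLaw.
Variables (T : finType) (p : T -> R).
Hypothesis p_law : is_law p.
Implicit Types E F : T -> Prop.

Lemma law_ge0 t : 0 <= p t. Proof. by case: p_law. Qed.

Lemma Pr_ge0 E : 0 <= Pr p E. Proof. by apply: sumr_ge0 => t _; exact: law_ge0. Qed.

Lemma Pr_true : Pr p (fun=> True) = 1.
Proof. by case: p_law => _ <-; apply: eq_bigl => t; rewrite asboolT. Qed.

Lemma Pr_not E : Pr p (fun t => ~ E t) = 1 - Pr p E.
Proof.
apply/eqP; rewrite eq_sym subr_eq -Pr_true /Pr (bigID (fun t => `[< E t >])) /= addrC.
by apply/eqP; congr (_ + _); apply: eq_bigl => t; rewrite asboolT ?asbool_neg.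
Qed.

Lemma Pr_le_expect E (F : T -> R) :
  (forall t, 0 <= F t) -> (forall t, E t -> 1 <= F t) -> Pr p E <= expect p F.
Proof.
move=> F_ge0 F_ge1; rewrite PrE; apply: ler_sum => t _; rewrite ler_wpM2r ?law_ge0 //.
by case: asboolP => // /F_ge1.
Qed.

Lemma le_Pr E F : (forall t, E t -> F t) -> Pr p E <= Pr p F.
Proof.
move=> EF; rewrite [leRHS]PrE; apply: Pr_le_expect => // t /EF Ft.
by rewrite asboolT.
Qed.

Lemma Pr_le1 E : Pr p E <= 1.
Proof. by rewrite -Pr_true; exact: le_Pr. Qed.

Lemma Pr_exists_le I (P : pred I) (E : I -> T -> Prop) :
  Pr p (fun t => exists2 i, P i & E i t) <= \sum_(i | P i) Pr p (E i).
Proof.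
pose F t : R := \sum_(i | P i) (`[< E i t >])%:R.
apply: (le_trans (Pr_le_expect (F := F) _ _)) => [t|t|].
- exact: sumr_ge0.
- by move=> [i Pi Eit]; rewrite /F (bigD1 i) //= asboolT // lerDl sumr_ge0.
rewrite /expect; under eq_bigr do rewrite big_distrl.
by rewrite exchange_big; under [leRHS]eq_bigr do rewrite PrE.
Qed.

Lemma Pr_or_le E F : Pr p (fun t => E t \/ F t) <= Pr p E + Pr p F.
Proof.
have -> : Pr p E + Pr p F = \sum_(b : bool | true) Pr p (if b then E else F).
  by rewrite big_bool.
apply: le_trans (Pr_exists_le _ _); apply: le_Pr => t.
by case=> [Et|Ft]; [exists true|exists false].
Qed.

Lemma law_push U (h : T -> U) : is_law (push h p).
Proof.
split=> [u|]; first exact: Pr_ge0.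
have <- : Pr (push h p) (fun=> True) = \sum_u push h p u.
  by apply: eq_bigl => u; rewrite asboolT.
by rewrite Pr_push Pr_true.
Qed.

Lemma push_cst U (u : U) : push (fun=> u) p u = 1.
Proof. by rewrite -Pr_true; apply: eq_Pr. Qed.

Lemma collision_prob_push_cst U (u : U) : collision_prob (push (fun=> u) p) = 1.
Proof.
transitivity (expect (push (fun=> u) p) (push (fun=> u) p)) => //.
rewrite expect_push -[RHS]Pr_true PrE.
by apply: eq_bigr => t _; rewrite push_cst asboolT.
Qed.

End OneLaw.

Section Independence.
Variables (I T : finType) (p : I -> T -> R).

Lemma expect_prod_law (F : I -> T -> R) :
  expect (prod_law p) (fun f => \prod_i F i (f i)) = \prod_i expect (p i) (F i).
Proof.
by rewrite bigA_distr_bigA; apply: eq_bigr => f _; rewrite -big_split.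
Qed.

Lemma Pr_prod_law (E : I -> T -> Prop) :
  Pr (prod_law p) (fun f => forall i, E i (f i)) = \prod_i Pr (p i) (E i).
Proof.
under [RHS]eq_bigr do rewrite PrE.
rewrite -expect_prod_law PrE; apply: eq_bigr => f _; congr (_ * _).
case: asboolP => [Ef|/existsNP[i nEi]].
  by rewrite big1 // => i _; rewrite asboolT.
by rewrite (bigD1 i) //= asboolF // mul0r.
Qed.

Lemma law_prod_law : (forall i, is_law (p i)) -> is_law (prod_law p).
Proof.
move=> p_law; split=> [f|]; first by apply: prodr_ge0 => i _; exact: law_ge0.
by rewrite -bigA_distr_bigA big1 // => i _; case: (p_law i).
Qed.

Lemma push_prod_law U (h : I -> T -> U) :
  push (fun f : {ffun I -> T} => [ffun i => h i (f i)]) (prod_law p)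
  =1 prod_law (fun i => push (h i) (p i)).
Proof.
move=> g; rewrite /prod_law -(Pr_prod_law (fun i t => h i t = g i)); apply: eq_Pr => f.
by split=> [<- i|fg]; [rewrite ffunE|apply/ffunP => i; rewrite ffunE fg].
Qed.

Lemma collision_prob_prod_law :
  collision_prob (prod_law p) = \prod_i collision_prob (p i).
Proof. exact: (expect_prod_law p). Qed.

End Independence.

End FiniteLaws.

(** * Independent samples of one law *)

Section Samples.
Variables (R : realDomainType) (I T : finType) (p : T -> R).
Hypothesis p_law : is_law p.
Local Notation iid := (@prod_law R I T (fun=> p)).

Let iid_law : is_law iid. Proof. exact: law_prod_law. Qed.

Lemma Pr_two_samples i j (E F : T -> Prop) : i != j ->
  Pr iid (fun f => E (f i) /\ F (f j)) = Pr p E * Pr p F.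
Proof.
move=> ij; pose G k t := (k = i -> E t) /\ (k = j -> F t).
rewrite (eq_Pr _ (F := fun f : {ffun I -> T} => forall k, G k (f k))) => [|f];
  last first.
  by split=> [[Ei Fj] k|Gf]; [split=> ->|split; [case: (Gf i)|case: (Gf j)] => *; auto].
rewrite Pr_prod_law (bigD1 i) //= (bigD1 j) //= 1?eq_sym // big1 => [|k /andP[ki kj]].
  rewrite mulr1; congr (_ * _); apply: eq_Pr => t; rewrite /G.
    by split=> [[Eit _]|Et]; [exact: Eit|split=> // /eqP; rewrite (negbTE ij)].
  by split=> [[_ Fjt]|Ft]; [exact: Fjt|split=> // /eqP; rewrite eq_sym (negbTE ij)].
rewrite -[RHS](Pr_true p_law); apply: eq_Pr => t; split=> // _.
by split=> /eqP; rewrite ?(negbTE ki) ?(negbTE kj).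
Qed.

Lemma Pr_collision i j : i != j -> Pr iid (fun f => f i = f j) = collision_prob p.
Proof.
move=> ij; rewrite /Pr (partition_big (fun f : {ffun I -> T} => f i) xpredT) //.
apply: eq_bigr => x _; rewrite expr2 -{1}(Pr_eq p x) -(Pr_eq p x).
rewrite -(Pr_two_samples _ _ ij) /Pr; apply: eq_bigl => f.
by apply/andP/asboolP => [[/asboolP <- /eqP]|[-> ->]]; rewrite ?asboolT.
Qed.

Lemma Pr_not_injective_le :
  Pr iid (fun f => ~ injective f) <= #|I|%:R ^+ 2 * collision_prob p.
Proof.
pose collides (ij : I * I) (f : {ffun I -> T}) := f ij.1 = f ij.2.
apply: (@le_trans _ _ (Pr iid (fun f => exists2 ij, ij.1 != ij.2 & collides ij f))).
  apply: (le_Pr iid_law) => f /existsNP[i /existsNP[j /not_implyP[fij ij]]].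
  by exists (i, j) => //; exact/eqP.
apply: (le_trans (Pr_exists_le iid_law _ _)).
apply: (@le_trans _ _ (\sum_(ij : I * I) collision_prob p)).
  rewrite big_mkcond; apply: ler_sum => -[i j] _ /=; case: ifP => ij.
    by rewrite (Pr_collision ij).
  by apply: sumr_ge0 => x _; exact: sqr_ge0.
by rewrite sumr_const card_prod -natrX mulr_natl mulnn.
Qed.

Lemma Pr_hit_at_most_once_le x : (0 < #|I|)%N ->
  Pr iid (fun f => #|[set i | f i == x]%SET| <= 1)%N <= #|I|%:R * (1 - p x) ^+ #|I|.-1.
Proof.
case/card_gt0P => i0 _.
pose missed_except i (f : {ffun I -> T}) := forall j, j != i -> f j <> x.
apply: (@le_trans _ _ (Pr iid (fun f => exists2 i, true & missed_except i f))).
  apply: (le_Pr iid_law) => f.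
  rewrite leq_eqVlt ltnS leqn0 => /orP[/cards1P[i hits]|/eqP/cards0_eq hits].
    by exists i => // j /eqP ji fj; apply: ji; apply/set1P; rewrite -hits inE fj.
  by exists i0 => // j _ fj; have := finset.in_set0 j; rewrite -hits inE fj eqxx.
apply: (le_trans (Pr_exists_le iid_law _ _)).
rewrite mulr_natl -sumr_const; apply: ler_sum => i _.
rewrite (Pr_prod_law _ (fun j t => j != i -> t <> x)) (bigD1 i) //=.
rewrite (le_trans (ler_piMl _ (Pr_le1 p_law _))) //.
  by apply: prodr_ge0 => j _; exact: Pr_ge0.
rewrite -[X in _ ^+ X](cardC1 i) -prodr_const; apply: ler_prod => j ji.
rewrite Pr_ge0 //= (eq_Pr _ (F := fun t => t <> x)) ?Pr_not ?Pr_eq // => t.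
by split=> [h|//]; exact: h.
Qed.

End Samples.

Section Birthday.
Variables (R : realType) (I T : finType) (p : T -> R).
Hypothesis p_law : is_law p.
Local Notation iid := (@prod_law R I T (fun=> p)).
Local Notation coincidence := (Num.sqrt (collision_prob p)).

Definition elem_sym (k : nat) : R :=
  \sum_(J : {set T} | #|J| == k) \prod_(x in J) p x.

Lemma Pr_injective_le_elem_sym :
  Pr iid (fun f => injective f) <= (#|I|)`!%:R * elem_sym #|I|.
Proof.
rewrite /Pr (eq_bigl (fun f : {ffun I -> T} => injectiveb f)); last first.
  by move=> f; apply/asboolP/injectiveP.
rewrite (partition_big (fun f : {ffun I -> T} => [set f i | i : I]%SET)
          (fun J => #|J| == #|I|)) /=; last first.
  by move=> f /injectiveP injf; rewrite card_imset.
rewrite /elem_sym big_distrr /=; apply: ler_sum => J /eqP cardJ.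
rewrite (eq_bigr (fun=> \prod_(x in J) p x)) => [|f /andP[/injectiveP injf /eqP <-]].
  rewrite sumr_const -[leLHS]mulr_natl ler_wpM2r //.
    by apply: prodr_ge0 => x _; exact: law_ge0.
  rewrite ler_nat -ffactnn -{1}cardJ -(card_inj_ffuns_on _ (mem J)) subset_leq_card //.
  apply/fintype.subsetP => f; rewrite !inE => /andP[-> /eqP imf]; rewrite andbT.
  by apply/ffun_onP => i; rewrite -imf imset_f.
by rewrite big_imset //=; apply: in2W.
Qed.

Lemma elem_sym_le (k : nat) (z : R) : 0 <= z ->
  z ^+ k * elem_sym k <= \prod_x (1 + z * p x).
Proof.
move=> z_ge0; have zp_ge0 x : 0 <= z * p x by rewrite mulr_ge0 ?law_ge0.
under [leRHS]eq_bigr do rewrite addrC.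
rewrite bigA_distr /= big_distrr /= big_mkcond; apply: ler_sum => J _.
case: ifP => [/eqP <-|_]; last by apply: prodr_ge0 => x _; case: ifP.
by rewrite -prodr_const -big_split [leLHS]big_mkcond lexx.
Qed.

Lemma prod_oneD_law_le (z : R) : 0 <= z -> 1 <= z * coincidence ->
  \prod_x (1 + z * p x) <= expR (z - z * coincidence / 8).
Proof.
move=> z_ge0; set m := z * coincidence => m_ge1.
have sqr_mE : m ^+ 2 = \sum_x (z * p x) ^+ 2.
  rewrite exprMn sqr_sqrtr ?sumr_ge0 // => [|x _]; last exact: sqr_ge0.
  by rewrite big_distrr; apply: eq_bigr => x _; rewrite exprMn.
apply: (@le_trans _ _ (expR (\sum_x (z * p x - (z * p x) ^+ 2 / (4 * (1 + m)))))).
  rewrite expR_sum; apply: ler_prod => x _.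
  have zp_ge0 : 0 <= z * p x by rewrite mulr_ge0 ?law_ge0.
  rewrite addr_ge0 //=; apply: (le_trans (oneD_le_expR zp_ge0)).
  rewrite ler_expR lerD2l lerN2 ler_wpM2l ?sqr_ge0 // lef_pV2 ?posrE; [|lra|lra].
  suff : z * p x <= m by lra.
  rewrite -(@ler_pXn2r _ 2) ?nnegrE //; last by lra.
  by rewrite sqr_mE (bigD1 x) //= lerDl sumr_ge0 // => y _; exact: sqr_ge0.
rewrite ler_expR sumrB -big_distrr -big_distrl -sqr_mE /=; case: (p_law) => _ ->.
by rewrite mulr1 lerD2l lerN2 ler_pdivlMr; [nra|lra].
Qed.

(* n! e_n(p) <= n! z^-n prod_x (1 + z p_x) for all z > 0; here z = n := #|I|. *)
Lemma Pr_injective_le (n := #|I|%:R : R) : 1 <= n * coincidence ->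
  Pr iid (fun f => injective f) <= expR 1 * n * expR (- (n * coincidence / 8)).
Proof.
move=> m_ge1; apply: (le_trans Pr_injective_le_elem_sym).
have [I_eq0|I_gt0] := posnP #|I|; first by move: m_ge1; rewrite /n I_eq0; lra.
have size_gt0 : 0 < n by rewrite ltr0n.
have e_le : n ^+ #|I| * elem_sym #|I| <= expR (n - n * coincidence / 8).
  apply: le_trans (elem_sym_le _ (ltW size_gt0)) (prod_oneD_law_le _ m_ge1).
  exact: ltW.
rewrite -(ler_pM2l (exprn_gt0 #|I| size_gt0)) mulrCA.
apply: (le_trans (ler_wpM2l _ e_le)) => //; rewrite expRD mulrA.
apply: (le_trans (ler_wpM2r (expR_ge0 _) (fact_mul_expR_le R I_gt0))).
by rewrite exprS -/n; lra.
Qed.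

End Birthday.

Section LowerTail.
Variables (R : realType) (I T : finType) (p : I -> T -> R) (Q : I -> pred T).
Hypothesis p_law : forall i, is_law (p i).

Lemma expect_if i (x : R) :
  expect (p i) (fun t => if Q i t then x else 1) = 1 - (1 - x) * Pr (p i) (Q i).
Proof.
case: (p_law i) => _ sum_p; rewrite PrE big_distrr -[X in X - _]sum_p -sumrB.
apply: eq_bigr => t _.
by rewrite asboolb; case: (Q i t) => /=; ring.
Qed.

Definition successes (D : {set I}) (f : {ffun I -> T}) : nat :=
  #|[set i in D | Q i (f i)]%SET|.

Lemma expect_expR_successes_le (D : {set I}) (s a : R) : 0 <= s <= 1 ->
    (forall i, i \in D -> a <= Pr (p i) (Q i)) ->
  expect (prod_law p) (fun f => expR (- s * (successes D f)%:R))
  <= expR (- (a * (s - s ^+ 2)) * #|D|%:R).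
Proof.
move=> /andP[s_ge0 s_le1] aQ.
pose F i t := if i \in D then if Q i t then expR (- s) else 1 else 1.
rewrite [leLHS](_ : _ = expect (prod_law p) (fun f => \prod_i F i (f i))); last first.
  apply: eq_bigr => f _; congr (_ * _); rewrite expRM_natr -prodr_const big_mkcond.
  by apply: eq_bigr => i _; rewrite inE /F; case: (i \in D).
rewrite expect_prod_law expRM_natr -prodr_const [leRHS]big_mkcond.
apply: ler_prod => i _; rewrite /F; case: ifP => [/aQ aQi|_]; last first.
  rewrite /expect; under eq_bigr do rewrite mul1r.
  by case: (p_law i) => _ ->; rewrite ler01 lexx.
have := Pr_le1 (p_law i) (Q i); have := Pr_ge0 (p_law i) (Q i).
rewrite expect_if; have := expR_gt0 (- s); have := expR_neg_le s_ge0.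
move: (Pr _ _) aQi => x a_le_x expR_s_le expR_s_gt0 x_ge0 x_le1.
apply/andP; split; first by nra.
apply: le_trans (expR_ge1Dx _); have : 0 <= s - s ^+ 2 by nra.
nra.
Qed.

(* The exponential Markov inequality with exponent eps / 2. *)
Lemma Pr_few_successes_le (D : {set I}) (a eps : R) : 0 < eps <= 1 ->
    (forall i, i \in D -> a <= Pr (p i) (Q i)) ->
  Pr (prod_law p) (fun f => (successes D f)%:R < (1 - eps) * a * #|D|%:R)
  <= expR (- (eps ^+ 2 / 4 * a * #|D|%:R)).
Proof.
move=> /andP[eps_gt0 eps_le1] aQ; set thr := _ * #|D|%:R; pose s := eps / 2.
have s_itv : 0 <= s <= 1 by rewrite /s; apply/andP; split; lra.
pose F (f : {ffun I -> T}) := expR (s * thr) * expR (- s * (successes D f)%:R).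
apply: (le_trans (Pr_le_expect (law_prod_law p_law) (F := F) _ _)) => [f|f few|].
- by rewrite mulr_ge0 ?expR_ge0.
- rewrite /F -expRD -[leLHS]expR0 ler_expR mulNr -mulrBr mulr_ge0 ?subr_ge0 ?(ltW few) //.
  by case/andP: s_itv.
rewrite /expect /F; under eq_bigr do rewrite -mulrA.
rewrite -big_distrr /=.
apply: (le_trans (ler_wpM2l (expR_ge0 _) (expect_expR_successes_le s_itv aQ))).
by rewrite -expRD ler_expR /thr /s; lra.
Qed.

End LowerTail.

Lemma card_small_sets_le (I : finType) r :
  (#|[set S : {set I} | (#|S| <= r)%N]%SET| <= #|I|.+1 ^ r)%N.
Proof.
pose range (h : {ffun 'I_r -> option I}) : {set I} := [set x | Some x \in codom h]%SET.
apply: (@leq_trans #|[set range h | h : {ffun 'I_r -> option I}]%SET|); last first.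
  by rewrite (leq_trans (leq_imset_card _ _)) // card_ffun card_option card_ord.
apply: subset_leq_card; apply/fintype.subsetP => S; rewrite inE => Sr.
pose h := [ffun k : 'I_r => nth None (map Some (enum S)) k].
apply/imsetP; exists h => //; apply/setP => x; rewrite inE.
apply/idP/codomP => [xS|[k]].
  have xr : (index x (enum S) < r)%N.
    by apply: leq_trans Sr; rewrite cardE index_mem mem_enum.
  exists (Ordinal xr); rewrite ffunE (nth_map x) ?nth_index ?mem_enum //.
  by rewrite index_mem mem_enum.
rewrite ffunE; have [kS|kS] := ltnP k (size (enum S)).
  by rewrite (nth_map x) // => -[->]; rewrite -mem_enum mem_nth.
by rewrite nth_default // size_map.
Qed.

Section SmallSets.
Variables (R : realDomainType) (I T : finType) (p : T -> R).
Hypothesis p_law : is_law p.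

Lemma Pr_exists_small_set_le r (B : R) (E : {set I} -> T -> Prop) : 0 <= B ->
  (forall S : {set I}, (#|S| <= r)%N -> Pr p (E S) <= B) ->
  Pr p (fun t => exists2 S : {set I}, (#|S| <= r)%N & E S t) <= #|I|.+1%:R ^+ r * B.
Proof.
move=> B_ge0 E_le; apply: (le_trans (Pr_exists_le p_law _ _)).
apply: (le_trans (ler_sum _ E_le)); rewrite sumr_const -[leLHS]mulr_natl.
by rewrite ler_wpM2r // -natrX ler_nat -cardsE card_small_sets_le.
Qed.

End SmallSets.

(** * Random matrices *)

Definition constant_obs N (b : bool) (S : {set 'I_N}) : {ffun 'I_N -> option bool} :=
  [ffun i => if i \in S then Some b else None].

Definition constant_cols N (b : bool) (S : {set 'I_N}) (A : 'M[bool]_N) : {set 'I_N} :=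
  [set v | restr_col A S v == constant_obs b S]%SET.

Definition row_count N (A : 'M[bool]_N) (D : {set 'I_N}) (b : bool) (i : 'I_N) : nat :=
  #|[set j in D | A i j == b]%SET|.

Section RandomMatrix.
Variables (R : realType) (N : nat) (q : R).
Hypothesis q01 : 0 < q < 1.
Implicit Types (A : 'M[bool]_N) (S D : {set 'I_N}).
Local Notation entry_law := (bernoulli_pmf q).
Local Notation vec_law := (@prod_law R 'I_N bool (fun=> entry_law)).
Local Notation iid law := (@prod_law R 'I_N _ (fun=> law)).

Definition mx_law A : R := \prod_(i < N) \prod_(j < N) entry_law (A i j).

Lemma random_matrix_probE E : random_matrix_prob q E = Pr mx_law E.
Proof. by []. Qed.

Lemma law_bernoulli : is_law entry_law.
Proof.
case/andP: q01 => q0 q1; split=> [b|]; first by rewrite bernoulli_pmf_ge0 // !ltW.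
by rewrite big_bool /bernoulli_pmf /= addrC subrK.
Qed.

Lemma law_vec : is_law vec_law.
Proof. by apply: law_prod_law => _; exact: law_bernoulli. Qed.

Lemma random_matrix_prob_rows (E : {ffun 'I_N -> {ffun 'I_N -> bool}} -> Prop) :
  random_matrix_prob q (fun A => E [ffun i => [ffun j => A i j]]) = Pr (iid vec_law) E.
Proof.
pose rows A : {ffun 'I_N -> {ffun 'I_N -> bool}} := [ffun i => [ffun j => A i j]].
rewrite random_matrix_probE [RHS]/Pr (reindex rows) /=; last first.
  pose mx (f : {ffun 'I_N -> {ffun 'I_N -> bool}}) : 'M[bool]_N :=
    \matrix_(i, j) f i j.
  apply: onW_bij; exists mx => [A|f].
    by apply/matrixP => i j; rewrite mxE !ffunE.
  by apply/ffunP => i; apply/ffunP => j; rewrite !ffunE mxE.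
apply: eq_bigr => A _; apply: eq_bigr => i _; apply: eq_bigr => j _.
by rewrite !ffunE.
Qed.

Lemma random_matrix_prob_trmx E :
  random_matrix_prob q (fun A => E A^T) = random_matrix_prob q E.
Proof.
rewrite !random_matrix_probE [RHS]/Pr (reindex (@trmx bool N N)) /=; last first.
  by apply: onW_bij; exists (@trmx bool N N); exact: trmxK.
apply: eq_bigr => A _; rewrite /mx_law exchange_big; apply: eq_bigr => i _.
by apply: eq_bigr => j _; rewrite mxE.
Qed.

Lemma random_matrix_prob_cols (E : {ffun 'I_N -> {ffun 'I_N -> bool}} -> Prop) :
  random_matrix_prob q (fun A => E [ffun v => [ffun i => A i v]]) = Pr (iid vec_law) E.
Proof.
rewrite -random_matrix_prob_rows -[RHS]random_matrix_prob_trmx.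
apply: eq_Pr => A.
suff -> : [ffun v => [ffun i => A i v]] = [ffun i => [ffun j => A^T i j]].
  by [].
by apply/ffunP => v; apply/ffunP => i; rewrite !ffunE mxE.
Qed.

Lemma law_mx : is_law mx_law.
Proof.
split=> [A|]; first by do 2 (apply: prodr_ge0 => ? _); case: law_bernoulli.
have iid_law : is_law (iid vec_law) by apply: law_prod_law => _; exact: law_vec.
rewrite -(Pr_true iid_law) -random_matrix_prob_rows.
by apply: eq_bigl => A; rewrite asboolT.
Qed.

Section Observations.
Variable S : {set 'I_N}.

Definition observe_entry (queried b : bool) : option bool :=
  if queried then Some b else None.

Definition observe (c : {ffun 'I_N -> bool}) : {ffun 'I_N -> option bool} :=
  [ffun i => observe_entry (i \in S) (c i)].

Definition obs_law : {ffun 'I_N -> option bool} -> R := push observe vec_law.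

Lemma law_obs : is_law obs_law.
Proof. exact: (law_push law_vec). Qed.

Lemma obs_lawE :
  obs_law =1 prod_law (fun i => push (observe_entry (i \in S)) entry_law).
Proof. exact: (push_prod_law (fun=> entry_law) (fun i => observe_entry (i \in S))). Qed.

Lemma collision_prob_obs_law : collision_prob obs_law = (q ^+ 2 + (1 - q) ^+ 2) ^+ #|S|.
Proof.
rewrite /collision_prob; under eq_bigr do rewrite obs_lawE.
rewrite -/(collision_prob _) collision_prob_prod_law -prodr_const [RHS]big_mkcond.
apply: eq_bigr => i _; case: (i \in S).
  by rewrite collision_prob_push_inj => [|b c []//]; rewrite /collision_prob big_bool.
exact: (collision_prob_push_cst law_bernoulli).
Qed.

Lemma obs_law_constant b : obs_law (constant_obs b S) = entry_law b ^+ #|S|.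
Proof.
rewrite obs_lawE -prodr_const [RHS]big_mkcond; apply: eq_bigr => i _.
rewrite ffunE; case: (i \in S); last exact: (push_cst law_bernoulli).
by rewrite (push_inj (h := Some)) // => c d [].
Qed.

Lemma random_matrix_prob_restr_col
    (E : {ffun 'I_N -> {ffun 'I_N -> option bool}} -> Prop) :
  random_matrix_prob q (fun A => E [ffun v => restr_col A S v]) = Pr (iid obs_law) E.
Proof.
rewrite -(eq_law_Pr E (push_prod_law (fun=> vec_law) (fun=> observe))) Pr_push.
rewrite -random_matrix_prob_cols; apply: eq_Pr => A.
suff -> : [ffun v => restr_col A S v]
        = [ffun v => observe ([ffun u => [ffun i => A i u]] v)] by [].
by apply/ffunP => v; rewrite !ffunE; apply/ffunP => i; rewrite !ffunE.
Qed.

Lemma prob_not_injective_restr_col_le :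
  random_matrix_prob q (fun A => ~ injective (restr_col A S))
  <= N%:R ^+ 2 * (q ^+ 2 + (1 - q) ^+ 2) ^+ #|S|.
Proof.
have := Pr_not_injective_le 'I_N law_obs.
rewrite collision_prob_obs_law card_ord -random_matrix_prob_restr_col; apply: le_trans.
apply: (le_Pr law_mx) => A; apply: contra_not => inj u v uv.
by apply: inj; rewrite !ffunE.
Qed.

Lemma prob_injective_restr_col_le :
  let mean := N%:R * Num.sqrt (q ^+ 2 + (1 - q) ^+ 2) ^+ #|S| in
  1 <= mean -> random_matrix_prob q (fun A => injective (restr_col A S))
               <= expR 1 * N%:R * expR (- (mean / 8)).
Proof.
have := @Pr_injective_le _ 'I_N _ _ law_obs.
rewrite collision_prob_obs_law card_ord -random_matrix_prob_restr_col.
rewrite sqrtrX ?addr_ge0 ?sqr_ge0 //.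
move=> le_inj mean /le_inj; apply: le_trans.
by apply: (le_Pr law_mx) => A inj u v; rewrite !ffunE => /inj.
Qed.

Lemma prob_few_constant_cols_le b : (0 < N)%N ->
  random_matrix_prob q (fun A => (#|constant_cols b S A| <= 1)%N)
  <= N%:R * (1 - entry_law b ^+ #|S|) ^+ N.-1.
Proof.
have := @Pr_hit_at_most_once_le _ 'I_N _ _ law_obs (constant_obs b S).
rewrite obs_law_constant card_ord -random_matrix_prob_restr_col => le_few /le_few.
apply: le_trans; apply: (le_Pr law_mx) => A.
by under [in X in _ -> X]eq_finset do rewrite ffunE.
Qed.

End Observations.

Lemma prob_unbalanced_rows_le D (a eps : R) : 0 < eps <= 1 -> a <= q -> a <= 1 - q ->
  random_matrix_prob q (fun A => forall i, exists b,
        (row_count A D b i)%:R < (1 - eps) * a * #|D|%:R)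
  <= (2 * expR (- (eps ^+ 2 / 4 * a * #|D|%:R))) ^+ N.
Proof.
move=> eps_itv aq a1q.
pose few b (c : {ffun 'I_N -> bool}) :=
  (successes (fun=> pred1 b) D c)%:R < (1 - eps) * a * #|D|%:R.
have few_le b : Pr vec_law (few b) <= expR (- (eps ^+ 2 / 4 * a * #|D|%:R)).
  apply: Pr_few_successes_le => // [_|i _]; first exact: law_bernoulli.
  rewrite (eq_Pr _ (F := fun c => c = b)) ?Pr_eq => [|c]; last by split=> /eqP.
  by rewrite /bernoulli_pmf; case: b.
apply: (@le_trans _ _
    (Pr (iid vec_law) (fun f => forall i, few true (f i) \/ few false (f i)))).
  rewrite -random_matrix_prob_rows; apply: (le_Pr law_mx) => A unbalanced i.
  suff fewE b : few b ([ffun i => [ffun j => A i j]] i)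
      = ((row_count A D b i)%:R < (1 - eps) * a * #|D|%:R).
    by rewrite !fewE; case: (unbalanced i) => -[]; [left|right].
  rewrite /few /successes /row_count ffunE; congr ((_)%:R < _).
  by apply: eq_card => j; rewrite !inE ffunE.
rewrite (Pr_prod_law _ (fun _ c => few true c \/ few false c)).
rewrite -[X in _ ^+ X]card_ord -prodr_const; apply: ler_prod => i _.
rewrite (Pr_ge0 law_vec) /=; apply: (le_trans (Pr_or_le law_vec _ _)).
by rewrite mulr_natl mulr2n lerD.
Qed.

End RandomMatrix.

(** * Query strategies on a fixed matrix *)

Section Minimum.
Local Open Scope nat_scope.
Implicit Types P Q : nat -> Prop.

Lemma minimum_Some P r : minimum P = Some r -> P r.
Proof.
rewrite /minimum; case: pselect => // ex [<-].
by case: ex_minnP => m /asboolP.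
Qed.

Lemma minimum_le P r : P r -> exists2 m, minimum P = Some m & m <= r.
Proof.
move=> /asboolT Pr; rewrite /minimum; case: pselect => [ex|[]]; last by exists r.
by exists (ex_minn ex) => //; case: ex_minnP => m _; exact.
Qed.

Lemma minimum_None P : (forall r, ~ P r) -> minimum P = None.
Proof.
by move=> nP; case min: minimum => [r|//]; case: (nP r); exact: minimum_Some.
Qed.

Lemma sub_minimum P Q r : (forall n, P n -> Q n) -> minimum P = Some r ->
  exists2 m, minimum Q = Some m & m <= r.
Proof. by move=> PQ /minimum_Some/PQ/minimum_le. Qed.

End Minimum.

Section ObservedColumns.
Variables (N : nat) (A : 'M[bool]_N).
Implicit Types (S : {set 'I_N}) (u v : 'I_N).

Lemma restr_colP S u v :
  reflect (forall i, i \in S -> A i u = A i v) (restr_col A S u == restr_col A S v).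
Proof.
apply: (iffP eqP) => [/ffunP eq_uv i iS|eq_uv].
  by have := eq_uv i; rewrite !ffunE iS => -[].
by apply/ffunP => i; rewrite !ffunE; case: ifP => // /eq_uv ->.
Qed.

Lemma restr_col_eq_subset S S' u v : S \subset S' ->
  restr_col A S' u = restr_col A S' v -> restr_col A S u = restr_col A S v.
Proof.
move=> /fintype.subsetP sub /eqP/restr_colP eq_uv; apply/eqP/restr_colP => i /sub.
exact: eq_uv.
Qed.

End ObservedColumns.

Section Candidates.
Local Open Scope nat_scope.
Variables (n : nat) (A : 'M[bool]_n.+1).
Implicit Types (S : {set 'I_n.+1}) (g : strategy) (u v : 'I_n.+1).

Lemma candidatesP S u v :
  reflect (restr_col A S u = restr_col A S v) (u \in candidates A S v).
Proof. by rewrite inE; exact: eqP. Qed.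

Lemma mem_candidates S v : v \in candidates A S v.
Proof. exact/candidatesP. Qed.

Lemma card_candidates_gt0 S v : 0 < #|candidates A S v|.
Proof. by apply/card_gt0P; exists v; exact: mem_candidates. Qed.

Lemma candidates_subset S S' v : S \subset S' ->
  candidates A S' v \subset candidates A S v.
Proof.
move=> sub; apply/fintype.subsetP => u /candidatesP eq_uv; apply/candidatesP.
exact: restr_col_eq_subset eq_uv.
Qed.

Lemma candidatesU1 S i v :
  candidates A (S :|: [set i])%SET v = [set u in candidates A S v | A i u == A i v]%SET.
Proof.
apply/setP => u; rewrite !inE.
apply/restr_colP/andP => [eq_uv|[/restr_colP eq_uv /eqP eq_i] k].
  split; first by apply/restr_colP => k kS; apply: eq_uv; rewrite !inE kS.
  by apply/eqP/eq_uv; rewrite !inE eqxx orbT.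
by rewrite !inE => /orP[/eq_uv|/eqP ->].
Qed.

Lemma queried_subset g v j k : j <= k -> queried g A v j \subset queried g A v k.
Proof.
move=> /subnK <-; elim: (k - j) => // d; rewrite addSn /= => sub.
by apply: (fintype.subset_trans sub); exact: finset.subsetUl.
Qed.

Lemma row_countD S i : row_count A S true i + row_count A S false i = #|S|.
Proof.
rewrite /row_count -(cardsID [set j | A i j]%SET S); congr (_ + _).
  by apply: eq_card => j; rewrite !inE; case: (A i j).
by apply: eq_card => j; rewrite !inE; case: (A i j); rewrite ?andbF ?andbT.
Qed.

End Candidates.

Section Undefined.
Local Open Scope nat_scope.
Variables (n : nat) (A : 'M[bool]_n.+1).

Lemma constant_cols_not_injective b S : 1 < #|constant_cols b S A| ->
  ~ injective (restr_col A S).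
Proof.
case/card_gt1P => u [v []]; rewrite !inE => /eqP cu /eqP cv uv injA.
by move/eqP: uv; apply; apply: injA; rewrite cu cv.
Qed.

Lemma SQC_undefined : ~ injective (restr_col A [set: 'I_n.+1]) -> SQC A = None.
Proof.
move=> /existsNP[u /existsNP[v /not_implyP[eq_uv /eqP uv]]].
apply: minimum_None => r [g /(_ v)/eqP/cards1P[w cand]]; move: uv.
have is_w z : restr_col A [set: 'I_n.+1] z = restr_col A [set: 'I_n.+1] v -> z = w.
  move=> eq_zv; apply/set1P; rewrite -cand; apply/candidatesP.
  exact: restr_col_eq_subset (finset.subsetT _) eq_zv.
by rewrite (is_w u) // (is_w v) // eqxx.
Qed.

Lemma QC_undefined : ~ injective (restr_col A [set: 'I_n.+1]) -> QC A = None.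
Proof.
move=> ninj; apply: minimum_None => r [S [_ injS]]; apply: ninj => u v eq_uv.
by apply: injS; exact: restr_col_eq_subset (finset.subsetT _) eq_uv.
Qed.

End Undefined.

Section LowerBounds.
Local Open Scope nat_scope.

Fixpoint queried_if_constant (g : strategy) n (A : 'M[bool]_n.+1) b j : {set 'I_n.+1} :=
  if j is k.+1 then
    let S := queried_if_constant g A b k in (S :|: [set g n A S (constant_obs b S)])%SET
  else finset.set0.

Lemma card_queried_if_constant g n (A : 'M[bool]_n.+1) b j :
  #|queried_if_constant g A b j| <= j.
Proof.
elim: j => [|j IH]; first by rewrite cards0.
by rewrite /= (leq_trans (leq_card_setU _ _)) // cards1 addn1.
Qed.

Lemma constant_cols_subset N (A : 'M[bool]_N) b (S S' : {set 'I_N}) : S \subset S' ->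
  constant_cols b S' A \subset constant_cols b S A.
Proof.
move=> /fintype.subsetP sub; apply/fintype.subsetP => u.
rewrite !inE => /eqP/ffunP const_u.
apply/eqP/ffunP => i; have := const_u i; rewrite !ffunE.
by case: (boolP (i \in S)) => // /sub ->.
Qed.

Lemma queried_constant_col g n (A : 'M[bool]_n.+1) b j u :
  u \in constant_cols b (queried_if_constant g A b j) A ->
  queried g A u j = queried_if_constant g A b j.
Proof.
elim: j => //= j IH const_u.
have {}const_u : u \in constant_cols b (queried_if_constant g A b j) A.
  apply: fintype.subsetP const_u; apply: constant_cols_subset.
  exact: finset.subsetUl.
by rewrite IH //; move: const_u; rewrite inE => /eqP ->.
Qed.

Lemma SQC_gt n (A : 'M[bool]_n.+1) b r0 r :
  (forall S : {set 'I_n.+1}, #|S| <= r0 -> 1 < #|constant_cols b S A|) ->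
  SQC A = Some r -> r0 < r.
Proof.
move=> many /minimum_Some[g idA]; rewrite ltnNge; apply/negP => r_le.
set S := queried_if_constant g A b r.
have /card_gt1P[u [v [uS vS uv]]] : 1 < #|constant_cols b S A|.
  by apply: many; exact: leq_trans (card_queried_if_constant _ _ _ _) r_le.
have := idA u; rewrite (queried_constant_col uS) -/S => /eqP/cards1P[w cand].
have is_w z : z \in constant_cols b S A -> z = w.
  move: uS; rewrite !inE => /eqP cu /eqP cz.
  by apply/set1P; rewrite -cand inE cz cu.
by move: uv; rewrite (is_w _ uS) (is_w _ vS) eqxx.
Qed.

Lemma QC_gt N (A : 'M[bool]_N) r0 r :
  (forall S : {set 'I_N}, #|S| <= r0 -> ~ injective (restr_col A S)) ->
  QC A = Some r -> r0 < r.
Proof.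
move=> ninj /minimum_Some[S [<- injS]]; rewrite ltnNge; apply/negP => /ninj.
exact.
Qed.

Lemma QC_le N (A : 'M[bool]_N) (S : {set 'I_N}) : injective (restr_col A S) ->
  exists2 r, QC A = Some r & r <= #|S|.
Proof. by move=> injS; apply: minimum_le; exists S. Qed.

Lemma SQC_le_SQC_by g n (A : 'M[bool]_n.+1) r : SQC_by g A = Some r ->
  exists2 m, SQC A = Some m & m <= r.
Proof. by apply: sub_minimum => k; exists g. Qed.

Lemma SQCP_le_SQC_by g n (A : 'M[bool]_n.+1) r :
  polynomial_time g -> SQC_by g A = Some r ->
  exists2 m, SQCP A = Some m & m <= r.
Proof. by move=> poly_g; apply: sub_minimum => k; exists g. Qed.

End LowerBounds.

(** * The greedy strategy *)

Arguments encode : simpl never.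

Section Encoding.
Local Open Scope nat_scope.

Lemma nth_allpairs_row (S T U : Type) (f : S -> T -> U) s t u0 s0 t0 k v :
  k < size s -> v < size t ->
  nth u0 [seq f i j | i <- s, j <- t] (k * size t + v) = f (nth s0 s k) (nth t0 t v).
Proof.
move=> + vt; elim: s k => // a s IH [_|k ks]; rewrite allpairs_cons nth_cat size_map.
  by rewrite mul0n add0n vt (nth_map t0).
by rewrite mulSn -addnA ltnNge leq_addr /= addKn IH.
Qed.

Variables (n : nat) (A : 'M[bool]_n.+1) (S : {set 'I_n.+1}) (vstar : 'I_n.+1).
Local Notation x := (encode A S (restr_col A S vstar)).

Let size_entries :
  size [seq nat_of_bool (A i j) | i <- enum 'I_n.+1, j <- enum 'I_n.+1] = n.+1 * n.+1.
Proof. by rewrite size_allpairs -cardT card_ord. Qed.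

Lemma nth_encode_entry (k v : 'I_n.+1) : nth 0 x (1 + k * n.+1 + v) = A k v.
Proof.
rewrite -addnA add1n /encode [nth _ _ _]/= nth_cat size_entries ifT; last first.
  by have := ltn_ord k; have := ltn_ord v; nia.
have := @nth_allpairs_row _ _ _ (fun i j => nat_of_bool (A i j)) (enum 'I_n.+1)
  (enum 'I_n.+1) 0 ord0 ord0 k v.
by rewrite -cardT card_ord !nth_ord_enum => ->.
Qed.

Lemma nth_encode_asked (k : 'I_n.+1) : nth 0 x (1 + n.+1 * n.+1 + k) = (k \in S).
Proof.
rewrite -addnA add1n /encode [nth _ _ _]/= nth_cat size_entries.
rewrite ltnNge leq_addr /= addKn.
rewrite nth_cat size_map -cardT card_ord ltn_ord (nth_map ord0).
  by rewrite nth_ord_enum.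
by rewrite -cardT card_ord.
Qed.

Lemma nth_encode_answer (k : 'I_n.+1) :
  nth 0 x (1 + n.+1 * n.+1 + n.+1 + k) = (k \in S) && A k vstar.
Proof.
rewrite -!addnA add1n /encode [nth _ _ _]/= nth_cat size_entries.
rewrite ltnNge leq_addr /= addKn.
rewrite nth_cat size_map -cardT card_ord ltnNge leq_addr /= addKn (nth_map ord0).
  by rewrite nth_ord_enum ffunE; case: (k \in S) => //=; case: (A k vstar).
by rewrite -cardT card_ord.
Qed.

Lemma alive_encode (v : 'I_n.+1) : alive x n.+1 v = (v \in candidates A S vstar).
Proof.
have -> : alive x n.+1 v = (mismatches_upto x n.+1 n.+1 v == 0).
  by rewrite /alive; case: (mismatches_upto _ _ _ _).
rewrite /mismatches_upto big_mkord sum_nat_eq0 inE; congr nat_of_bool.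
apply/forall_inP/restr_colP => agree k; have := agree k;
  rewrite nth_encode_entry nth_encode_asked nth_encode_answer.
  by move=> + kS; rewrite kS => /(_ isT); case: (A k v) (A k vstar) => -[].
by case: (k \in S) => [/(_ isT) ->|_] //; case: (A k v) => //; case: (A k vstar).
Qed.

Lemma row_score_encode (i : 'I_n.+1) : row_score x n.+1 i =
  minn (row_count A (candidates A S vstar) true i)
       (row_count A (candidates A S vstar) false i).
Proof.
rewrite /row_score /ones_upto /zeros_upto !big_mkord /row_count -!sum1_card.
by congr minn; rewrite [RHS]big_mkcond; apply: eq_bigr => v _;
  rewrite inE alive_encode nth_encode_entry; case: (v \in _); case: (A i v).
Qed.

End Encoding.

Section Greedy.
Local Open Scope nat_scope.

Lemma best_upto_lt x N j : 0 < N -> j <= N -> (best_upto x N j).1 < N.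
Proof.
by move=> N0; elim: j => //= j IH jN; case: ifP => _ //=; exact: IH (ltnW jN).
Qed.

Lemma row_score_le_best x N j i : i < j -> row_score x N i <= (best_upto x N j).2.
Proof.
elim: j => //= j IH; rewrite ltnS leq_eqVlt => /orP[/eqP <-|/IH le_i].
  by case: ltnP.
by case: ltnP => //= best_lt; exact: leq_trans (ltnW best_lt).
Qed.

Lemma best_le_row_score x N j :
  (best_upto x N j).2 <= row_score x N (best_upto x N j).1.
Proof. by elim: j => //= j IH; case: ifP. Qed.

Definition greedy : strategy := fun n A S y =>
  inord (best_upto (encode A S y) n.+1 n.+1).1.

Lemma greedy_polynomial_time : polynomial_time greedy.
Proof.
exists (compile 0 greedy_code), 100 => n A S v /=.
by rewrite /greedy inordK ?best_upto_lt //; exact: greedy_code_outputs.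
Qed.

Lemma greedy_max n (A : 'M[bool]_n.+1) S v (i : 'I_n.+1) :
  let D := candidates A S v in let k := greedy A S (restr_col A S v) in
  minn (row_count A D true i) (row_count A D false i)
  <= minn (row_count A D true k) (row_count A D false k).
Proof.
rewrite /= -!row_score_encode; apply: leq_trans (row_score_le_best _ _ (ltn_ord i)) _.
by rewrite /greedy inordK ?best_upto_lt // best_le_row_score.
Qed.

Variables (n : nat) (A : 'M[bool]_n.+1) (v : 'I_n.+1).
Local Notation cand j := (candidates A (queried greedy A v j) v).

Lemma card_cand_greedyS j i :
  #|cand j.+1| + minn (row_count A (cand j) true i) (row_count A (cand j) false i)
  <= #|cand j|.
Proof.
set k := greedy A (queried greedy A v j) (restr_col A (queried greedy A v j) v).
have -> : cand j.+1 = [set u in cand j | A k u == A k v]%SET by exact: candidatesU1.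
rewrite -/(row_count A (cand j) (A k v) k).
have := row_countD A (cand j) k; have := greedy_max A (queried greedy A v j) v i.
rewrite -/k /=; case: (A k v); lia.
Qed.

Lemma card_cand_homo j k : j <= k -> #|cand k| <= #|cand j|.
Proof. by move=> jk; apply/subset_leq_card/candidates_subset/queried_subset. Qed.

Lemma card_cand_greedy_decr j : injective (restr_col A [set: 'I_n.+1]) ->
  1 < #|cand j| -> #|cand j.+1| < #|cand j|.
Proof.
move=> injA /card_gt1P[u [w [uD wD uw]]].
have /existsP[i neq_i] : [exists i, A i u != A i w].
  apply: contraNT uw; rewrite negb_exists => /forallP eq_uw.
  apply/eqP/injA/eqP/restr_colP => i _.
  exact/eqP/negPn.
have row_count_gt0 b : 0 < row_count A (cand j) b i.
  apply/card_gt0P; have [ub|nub] := eqVneq (A i u) b; [exists u|exists w];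
    rewrite inE ?uD ?wD.
    exact/eqP.
  by move: neq_i nub; case: (A i u) (A i w) b => [] [] [].
have := card_cand_greedyS j i.
have := row_count_gt0 true; have := row_count_gt0 false; lia.
Qed.

Lemma card_cand_greedy_le j m : injective (restr_col A [set: 'I_n.+1]) ->
  #|cand (j + m)| <= maxn 1 (#|cand j| - m).
Proof.
move=> injA; elim: m => [|m IH]; first by rewrite addn0 subn0 leq_maxr.
rewrite addnS; have [le1|] := leqP #|cand (j + m)| 1.
  by rewrite leq_max (leq_trans (card_cand_homo (leqnSn _)) le1).
by move=> /(card_cand_greedy_decr injA); move: IH; lia.
Qed.

End Greedy.

Section GreedyIdentifies.
Variables (R : realType) (n : nat) (A : 'M[bool]_n.+1) (K rho : R).
Hypothesis rho01 : 0 <= rho <= 1.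
Hypothesis balanced : forall D : {set 'I_n.+1}, K <= #|D|%:R ->
  exists i, forall b, (1 - rho) * #|D|%:R <= (row_count A D b i)%:R.

Lemma card_cand_greedy_geometric v j :
  (#|candidates A (queried greedy A v j) v|)%:R <= Num.max K (n.+1%:R * rho ^+ j).
Proof.
case/andP: rho01 => rho0 rho1; elim: j => [|j IH].
  by rewrite expr0 mulr1 le_max ler_nat -[X in (_ <= X)%N]card_ord max_card orbT.
set D := candidates A (queried greedy A v j) v in IH *.
have [KD|DK] := leP K #|D|%:R; last first.
  by rewrite le_max (le_trans _ (ltW DK)) // ler_nat card_cand_homo.
have [i bal_i] := balanced KD.
have bal_min : (1 - rho) * #|D|%:R
    <= (minn (row_count A D true i) (row_count A D false i))%:R.
  by rewrite /minn; case: ifP => _; exact: bal_i.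
have := card_cand_greedyS A v j i; rewrite -/D -(ler_nat R) natrD => step.
apply: (@le_trans _ _ (rho * #|D|%:R)); first by lra.
move: IH; rewrite !le_max => /orP[KD'|DN]; apply/orP.
  by left; apply: le_trans KD'; rewrite ler_piMl.
by right; rewrite exprS mulrCA ler_wpM2l.
Qed.

(* Above K candidates, a balanced row keeps a fraction rho of them; below K, a
   row separating two candidates removes at least one. *)
Lemma greedy_identifies (J M : nat) : injective (restr_col A [set: 'I_n.+1]) ->
  n.+1%:R * rho ^+ J <= K -> K < M.+1%:R -> identifies greedy A (J + M).
Proof.
move=> injA NJ KM v; apply/eqP; rewrite eqn_leq card_candidates_gt0 andbT.
apply: (leq_trans (card_cand_greedy_le v J M injA)); rewrite geq_max /=.
rewrite leq_subLR addn1 ltnW // -(ltr_nat R); apply: le_lt_trans KM.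
by apply: (le_trans (card_cand_greedy_geometric v J)); rewrite ge_max lexx.
Qed.

End GreedyIdentifies.

(** * Estimates of the number of queries *)

Section DecayRate.
Variables (R : realType) (g : R).
Hypothesis g_itv : 2^-1 <= g < 1.
Local Notation L := (ln (1 / g)).

Let g_gt0 : 0 < g. Proof. by case/andP: g_itv => *; lra. Qed.

Lemma expR_Nln_inv : expR (- L) = g.
Proof. by rewrite div1r lnV ?posrE // opprK lnK ?posrE. Qed.

Lemma onem_le_ln_inv : 1 - g <= L.
Proof. by have := expR_ge1Dx (- L); rewrite expR_Nln_inv; lra. Qed.

Lemma ln_inv_gt0 : 0 < L.
Proof. by have := onem_le_ln_inv; case/andP: g_itv => *; lra. Qed.

Lemma ln_inv_le : L <= 2 * (1 - g).
Proof.
have : L <= g^-1 - 1.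
  by have := expR_ge1Dx L; rewrite {2}div1r lnK ?posrE ?invr_gt0 //; lra.
move=> /le_trans; apply; case/andP: g_itv => g_ge g_lt1.
have -> : g^-1 - 1 = g^-1 * (1 - g) by field; lra.
by apply: ler_wpM2r; [lra|rewrite invf_ple ?posrE].
Qed.

Lemma ln_inv_le1 : L <= 1.
Proof. by have := ln_inv_le; case/andP: g_itv => *; lra. Qed.

End DecayRate.

Section LowerThreshold.
Variables (R : realType) (gamma : nat -> R).
Hypothesis gamma_itv : forall N, 2^-1 <= gamma N < 1.

Definition lower_rate (eps : R) (n : nat) : R :=
  (eta_exp gamma n.+1 - eps) * query_rate gamma n.+1.

Definition lower_threshold (eps : R) (n : nat) : nat := Num.truncn (lower_rate eps n).

Lemma lower_rate_le eps n r : (lower_threshold eps n < r)%N -> lower_rate eps n <= r%:R.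
Proof. by move=> ltr; apply: le_trans (ltW (truncnS_gt _)) _; rewrite ler_nat. Qed.

Lemma lower_threshold_mul_ln_le eps n (L := ln (1 / gamma n.+1)) (l := ln n.+1%:R) :
  0 < l -> (0 < lower_threshold eps n)%N ->
  (lower_threshold eps n)%:R * L <= l + ln L - eps * l.
Proof.
move=> l_gt0; have L_gt0 : 0 < L by exact: ln_inv_gt0.
rewrite /lower_threshold /lower_rate /eta_exp /query_rate -/L -/l; set X := _ * (l / L).
rewrite truncn_gt0 => X_ge1.
have -> : l + ln L - eps * l = X * L by rewrite /X; field; rewrite !lt0r_neq0.
by rewrite ler_pM2r // truncn_le (le_trans ler01).
Qed.

(* With N = n.+1, N gamma^r is the order of magnitude of the number of columns
   that r queries fail to separate. *)
Lemma powR_le_survivors eps n (N := n.+1%:R : R) (r := lower_threshold eps n)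
    (survivors := N * gamma n.+1 ^+ r) : 0 < eps <= 1 -> (0 < n)%N ->
  N `^ eps <= survivors /\ r%:R * N `^ eps <= ln N * survivors.
Proof.
move=> /andP[eps_gt0 eps_le1] n_gt0; have N_ge1 : 1 <= N by rewrite ler1n.
have l_gt0 : 0 < ln N by rewrite ln_natS_gt0.
rewrite /survivors => {survivors}; have [->|r_gt0] := posnP r.
  by rewrite expr0 mulr1 ler1_powR // mul0r mulr_ge0 // ltW.
set L := ln (1 / gamma n.+1); have L_gt0 : 0 < L by exact: ln_inv_gt0.
have Lr_le : r%:R * L <= ln N + ln L - eps * ln N by exact: lower_threshold_mul_ln_le.
move: (r) r_gt0 Lr_le => {}r _ Lr_le.
have lnL_le0 : ln L <= 0 by rewrite ln_le0 // ln_inv_le1.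
have epsl_ge0 : 0 <= eps * ln N by rewrite mulr_ge0 // ltW.
have powR_div_le : N `^ eps / L <= N * gamma n.+1 ^+ r.
  have -> : N * gamma n.+1 ^+ r = expR (ln N - r%:R * L).
    by rewrite expRD -mulrN expRM_natl expR_Nln_inv // expR_ln_natS.
  by rewrite powR_natSE -[X in _ / X](lnK (x := L)) ?posrE // -expRB ler_expR; lra.
have powR_N_ge0 : 0 <= N `^ eps by exact: powR_ge0.
split.
  apply: le_trans powR_div_le; rewrite ler_pdivlMr // ler_piMr //.
  exact: ln_inv_le1.
apply: le_trans (ler_wpM2l (ltW l_gt0) powR_div_le).
by rewrite mulrCA [leRHS]mulrC ler_wpM2r // ler_pdivlMr //; lra.
Qed.

Lemma union_bound_le_harmonic eps n (N := n.+1%:R : R) (r := lower_threshold eps n) :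
  0 < eps <= 1 -> 1 <= ln N -> 40 * ln N ^+ 2 <= N `^ eps ->
  n.+2%:R ^+ r * (expR 1 * N * expR (- (N * gamma n.+1 ^+ r / 8))) <= harmonic n.
Proof.
move=> eps_itv l_ge1 sqr_l_le.
have n_gt0 : (0 < n)%N by rewrite -(ln_natS_gt0 R) (lt_le_trans ltr01).
have [] := powR_le_survivors eps_itv n_gt0; rewrite -/N -/r.
set l := ln N in l_ge1 sqr_l_le *; set survivors := N * _ => power_le r_power_le.
have natSS_le : n.+2%:R <= expR (2 * l) :> R.
  rewrite expRM_natl (expR_ln_natS R n) -natrX ler_nat.
  by rewrite -mulnn; nia.
have rl_le : 40 * (l * r%:R) <= survivors.
  rewrite -(ler_pM2l (lt_le_trans ltr01 l_ge1)); apply: le_trans r_power_le.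
  apply: le_trans (ler_wpM2l (ler0n R r) sqr_l_le).
  lra.
have l_le : l <= l ^+ 2 by rewrite expr2 ler_peMr // (le_trans ler01).
apply: (@le_trans _ _
    (expR (2 * l * r%:R) * (expR 1 * expR l * expR (- (survivors / 8))))).
  rewrite (expR_ln_natS R n) ler_wpM2r ?mulr_ge0 ?expR_ge0 //.
  by rewrite expRM_natr lerXn2r ?nnegrE ?expR_ge0.
rewrite -!expRD /harmonic /= -(expR_ln_natS R n) -expRN ler_expR -/N -/l.
lra.
Qed.

End LowerThreshold.

Section UpperEstimates.
Variables (R : realType) (g eps : R) (n : nat).
Hypothesis g_itv : 2^-1 <= g < 1.
Local Notation N := (n.+1%:R : R).
Local Notation l := (ln N).
Local Notation L := (ln (1 / g)).
Local Notation rate := (l / L).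

Lemma exists_separating_size : 0 < eps <= 1 -> 2 <= eps * l -> 4 * l <= (1 - g) * N ->
  exists r : nat, [/\ (r <= n.+1)%N, r%:R <= (1 + eps) * rate
    & N ^+ 2 * (g ^+ 2) ^+ r <= N `^ (- eps)].
Proof.
move=> /andP[eps_gt0 eps_le1] epsl_ge2 gap_ge; have L_gt0 : 0 < L by exact: ln_inv_gt0.
have l_gt0 : 0 < l by rewrite -(pmulr_rgt0 _ eps_gt0); lra.
have rate_ge : 2 <= eps * rate.
  by rewrite mulrA ler_pdivlMr // (le_trans _ epsl_ge2) // ler_piMr // ln_inv_le1.
pose Y := (1 + eps / 2) * rate; have Y_ge0 : 0 <= Y by rewrite /Y mulrDl; nra.
have /andP[Y_ge Y_lt] := truncn_itv Y_ge0; exists (Num.truncn Y).+1.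
have r_le : (Num.truncn Y).+1%:R <= (1 + eps) * rate.
  by rewrite -natr1; rewrite /Y in Y_ge *; lra.
split=> //.
  rewrite -(ler_nat R); apply: (le_trans r_le).
  rewrite mulrA ler_pdivrMr //; have := ler_wpM2l (ler0n R n.+1) (onem_le_ln_inv g_itv).
  by have : eps * l <= l; [rewrite ler_piMl // ltW|lra].
rewrite -{1}(expR_Nln_inv g_itv) powR_natSE -[X in X ^+ 2 * _](expR_ln_natS R n).
rewrite -!expRM_natl -expRD ler_expR.
move: (ltW Y_lt); rewrite /Y mulrA ler_pdivrMr //; lra.
Qed.

Lemma balanced_ratio_le : 0 < eps <= 8^-1 ->
  1 - (1 - eps) * (1 - g) <= expR (- ((1 - 2 * eps) * L)).
Proof.
move=> /andP[eps_gt0 eps_le].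
have -> : - ((1 - 2 * eps) * L) = - L + 2 * eps * L by ring.
rewrite expRD expR_Nln_inv //; have /andP[g_ge g_lt1] := g_itv.
have expR_ge : 1 + 2 * eps * (1 - g) <= expR (2 * eps * L).
  apply: le_trans (expR_ge1Dx _); rewrite lerD2l ler_wpM2l ?onem_le_ln_inv //.
  by lra.
have := ler_wpM2l (le_trans (_ : 0 <= 2^-1) g_ge) expR_ge.
have : 0 <= eps * (1 - g) * (2 * g - 1) by rewrite !mulr_ge0; lra.
lra.
Qed.

Lemma balanced_ratio_power_le J : 0 < eps <= 8^-1 -> l <= (1 - 2 * eps) * L * J%:R ->
  N * (1 - (1 - eps) * (1 - g)) ^+ J <= 1.
Proof.
move=> eps_itv l_le; have /andP[eps_gt0 eps_le] := eps_itv.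
have /andP[g_ge g_lt1] := g_itv.
have ratio_ge0 : 0 <= 1 - (1 - eps) * (1 - g).
  by have : 0 <= eps * (1 - g); [rewrite mulr_ge0; lra|lra].
have power_le : (1 - (1 - eps) * (1 - g)) ^+ J <= expR (- l).
  apply: (@le_trans _ _ (expR (- ((1 - 2 * eps) * L)) ^+ J)).
    by rewrite lerXn2r ?nnegrE ?expR_ge0 ?balanced_ratio_le.
  by rewrite -expRM_natr ler_expR mulNr lerN2.
apply: (le_trans (ler_wpM2l (ler0n R n.+1) power_le)).
by rewrite expRN expR_ln_natS divff.
Qed.

Lemma exists_greedy_phases (K := eps * l / (1 - g)) :
  0 < eps <= 8^-1 -> 1 <= eps * l ->
  exists J M : nat, [/\ N * (1 - (1 - eps) * (1 - g)) ^+ J <= K, K < M.+1%:R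
    & (J + M)%:R <= (1 + 7 * eps) * rate].
Proof.
move=> eps_itv epsl_ge1; have /andP[eps_gt0 eps_le] := eps_itv.
have /andP[g_ge g_lt1] := g_itv; have L_gt0 : 0 < L by exact: ln_inv_gt0.
have l_gt0 : 0 < l by rewrite -(pmulr_rgt0 _ eps_gt0); lra.
have speed_gt0 : 0 < (1 - 2 * eps) * L by rewrite mulr_gt0 //; lra.
pose Y := l / ((1 - 2 * eps) * L).
have Y_ge : (Num.truncn Y)%:R <= Y by rewrite truncn_le ltW // divr_gt0.
have K_ge : (Num.truncn K)%:R <= K by rewrite truncn_le divr_ge0; lra.
exists (Num.truncn Y).+1, (Num.truncn K); split; last 1 first.
- have Y_le : Y <= (1 + 4 * eps) * rate.
    have -> : Y = rate / (1 - 2 * eps) by rewrite /Y; field; lra.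
    rewrite ler_pdivrMr; last by lra.
    rewrite mulrAC ler_peMl ?divr_ge0 ?(ltW l_gt0) ?(ltW L_gt0) //.
    by have : 0 <= eps * (8^-1 - eps); [rewrite mulr_ge0; lra|lra].
  have K_le : K <= 2 * eps * rate.
    have -> : 2 * eps * rate = eps * l * (2 / L) by ring.
    rewrite ler_wpM2l //; first by lra.
    by rewrite ler_pdivlMr // mulrC ler_pdivrMr ?ln_inv_le //; lra.
  have rate_ge : 1 <= eps * rate.
    by rewrite mulrA ler_pdivlMr // [leLHS]mul1r (le_trans (ln_inv_le1 g_itv)).
  by rewrite natrD -natr1; lra.
- apply: (@le_trans _ _ 1); last by rewrite ler_pdivlMr ?mul1r; lra.
  by apply: balanced_ratio_power_le; rewrite // mulrC -ler_pdivrMr // ltW ?truncnS_gt.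
exact: truncnS_gt.
Qed.

End UpperEstimates.

Section Gamma.
Variables (R : realType) (q : nat -> R).
Hypothesis q01 : forall N, 0 < q N < 1.
Local Notation gs := (gamma_sqc q).
Local Notation gq := (gamma_qc q).

Definition majority N : bool := 1 - q N <= q N.

Lemma gamma_sqcE N : gs N = bernoulli_pmf (q N) (majority N).
Proof.
rewrite /gamma_sqc /majority /bernoulli_pmf; case: ifP => [/max_idPl //|/negbT].
by rewrite -ltNge => /ltW/max_idPr.
Qed.

Lemma onem_gamma_sqc_le N : 1 - gs N <= q N /\ 1 - gs N <= 1 - q N.
Proof.
split; last by rewrite lerD2l lerN2 le_max lexx.
by rewrite lerBlDr -lerBlDl le_max lexx orbT.
Qed.

Lemma gamma_sqc_itv N : 2^-1 <= gs N < 1.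
Proof.
have /andP[q0 q1] := q01 N; rewrite gt_max q1 gtrBl q0 andbT le_max.
by have [] := leP 2^-1 (q N) => //= ?; lra.
Qed.

Lemma gamma_qc_sqr N : gq N ^+ 2 = q N ^+ 2 + (1 - q N) ^+ 2.
Proof. by rewrite sqr_sqrtr // addr_ge0 // sqr_ge0. Qed.

Lemma gamma_qc_sqr_le N : gq N ^+ 2 <= gs N.
Proof.
have [pq p1q] := onem_gamma_sqc_le N; have /andP[q0 q1] := q01 N.
rewrite gamma_qc_sqr; nra.
Qed.

Lemma gamma_qc_itv N : 2^-1 <= gq N < 1.
Proof.
have g0 : 0 <= gq N by exact: sqrtr_ge0.
have g_lt1 : gq N < 1.
  rewrite -(@ltr_pXn2r _ 2) ?nnegrE // expr1n.
  by apply: le_lt_trans (gamma_qc_sqr_le N) _; case/andP: (gamma_sqc_itv N).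
have sqr_ge : 2^-1 <= gq N ^+ 2.
  by rewrite gamma_qc_sqr; have := sqr_ge0 (q N - 2^-1); rewrite !expr2; lra.
by rewrite g_lt1 andbT (le_trans sqr_ge) // expr2 ler_piMr // ltW.
Qed.

Lemma onem_gamma_sqc_le_qc N : 1 - gs N <= 2 * (1 - gq N).
Proof.
have := gamma_qc_sqr_le N; have := sqr_ge0 (gq N - 1).
by rewrite !expr2; lra.
Qed.

Lemma onem_gamma_sqc_gt0 N : 0 < 1 - gs N.
Proof. by rewrite subr_gt0; case/andP: (gamma_sqc_itv N). Qed.

Lemma onem_gamma_qc_gt0 N : 0 < 1 - gq N.
Proof. by rewrite subr_gt0; case/andP: (gamma_qc_itv N). Qed.

End Gamma.

(** * Asymptotics *)

Section NearInfinity.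
Local Open Scope classical_set_scope.
Local Open Scope nat_scope.

Lemma near_succ (P : nat -> Prop) : (\forall N \near \oo, P N) ->
  \forall n \near \oo, P n.+1.
Proof. by case=> M _ PM; exists M => // n Mn; apply: PM; exact: leqW. Qed.

Lemma near_diagonal (P : nat -> nat -> Prop) :
  (forall k, \forall n \near \oo, P k n) ->
  exists k : nat -> nat, (forall m, \forall n \near \oo, m <= k n)
                      /\ \forall n \near \oo, P (k n) n.
Proof.
move=> nearP; pose k n := \max_(i < n.+1 | `[< P i n >]) i.
have kP m : \forall n \near \oo, m <= k n /\ P (k n) n.
  apply: filterS2 (nbhs_infty_ge m) (nearP m) => n mn /asboolT Pmn.
  have mn' : m < n.+1 by [].
  have Pmn' : `[< P (Ordinal mn') n >] := Pmn.
  split; first exact: (leq_bigmax_cond _ Pmn').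
  rewrite /k (bigop.bigmax_eq_arg (Ordinal mn')) //.
  by case: arg_maxnP => // i /asboolP.
exists k; split=> [m|]; first by apply: filterS (kP m) => n [].
by apply: filterS (kP 0) => n [].
Qed.

End NearInfinity.

Section Growth.
Local Open Scope classical_set_scope.
Local Open Scope ring_scope.
Variable R : realType.

Lemma near_ln_ge (M : R) : \forall n \near \oo, M <= ln n.+1%:R.
Proof.
have := near_succ (nbhs_infty_ger (expR M)); apply: filterS => n le_n.
by rewrite -[leLHS]expRK ler_ln ?posrE ?expR_gt0.
Qed.

Lemma near_sqr_ln_le_powR (c M : R) : 0 < c ->
  \forall n \near \oo, M * ln n.+1%:R ^+ 2 <= n.+1%:R `^ c.
Proof.
move=> c_gt0; have := near_ln_ge (6 * `|M| / c ^+ 3); have := near_ln_ge 0.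
apply: filterS2 => n l_ge0 l_ge; rewrite powR_natSE; set l := ln _ in l_ge0 l_ge *.
have cl_ge0 : 0 <= c * l by rewrite mulr_ge0 // ltW.
apply: le_trans (le_trans _ (expR_ge1Dxn 2 cl_ge0)).
  by apply: ler_wpM2r (ler_norm M); exact: sqr_ge0.
rewrite (_ : 3`!%:R = 6 :> R) // ler_wpDl // exprMn ler_pdivlMr //.
move: l_ge; rewrite ler_pdivrMr ?exprn_gt0 // => l_ge.
have := ler_wpM2r (sqr_ge0 l) l_ge; lra.
Qed.

Lemma cvg_powRN (c : R) : 0 < c -> n.+1%:R `^ (- c) @[n --> \oo] --> (0 : R).
Proof.
move=> c_gt0; under eq_fun do rewrite powR_natSE mulNr.
apply: (@cvg_comp _ _ _ (fun n => c * ln n.+1%:R) (fun x => expR (- x))) (@cvgr_expR R).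
apply/cvgryPge => M; have := near_ln_ge (M / c).
by apply: filterS => n; rewrite ler_pdivrMr // mulrC.
Qed.

Lemma near_ge_logN_over_N (h : nat -> R) (C : R) : (forall N, 0 < h N) -> 0 < C ->
  much_less (@logN_over_N R) h ->
  \forall n \near \oo, C * ln n.+1%:R <= h n.+1 * n.+1%:R.
Proof.
move=> h_gt0 C_gt0 /cvgrPdist_le/(_ C^-1); rewrite invr_gt0 => /(_ C_gt0)/near_succ.
apply: filterS => n; rewrite sub0r normrN /logN_over_N => /(le_trans (ler_norm _)).
by rewrite ler_pdivrMr ?h_gt0 // ler_pdivrMr // -mulrA ler_pdivlMl.
Qed.

Lemma near_le_logN_over_N (h : nat -> R) (c : R) : 0 < c ->
  much_less h (@logN_over_N R) ->
  \forall n \near \oo, h n.+1 * n.+1%:R <= c * ln n.+1%:R.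
Proof.
move=> c_gt0 /cvgrPdist_le/(_ c c_gt0)/near_succ; have := near_ln_ge 1.
apply: filterS2 => n l1; rewrite sub0r normrN /logN_over_N => /(le_trans (ler_norm _)).
by rewrite ler_pdivrMr ?divr_gt0 ?mulrA ?ler_pdivlMr // (lt_le_trans ltr01).
Qed.

End Growth.

Section RandomMatrixAsymptotics.
Local Open Scope classical_set_scope.
Local Open Scope ring_scope.
Variables (R : realType) (q : nat -> R).
Hypothesis q01 : forall N, 0 < q N < 1.
Local Notation gs := (gamma_sqc q).
Local Notation gq := (gamma_qc q).
Implicit Types E F : forall n, 'M[bool]_n.+1 -> Prop.
Local Notation prob n E := (random_matrix_prob (q n.+1) E).

Let mx_is_law n : is_law (@mx_law R n.+1 (q n.+1)). Proof. exact: law_mx. Qed.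

Lemma aas_ge E (f : nat -> R) : f n @[n --> \oo] --> (1 : R) ->
  (\forall n \near \oo, f n <= prob n (E n)) -> aas q E.
Proof.
move=> f1 le_f; apply: squeeze_cvgr f1 (cvg_cst (1 : R)).
apply: filterS le_f => n -> /=.
by rewrite random_matrix_probE (Pr_le1 (mx_is_law n)).
Qed.

Lemma aas_of_prob_not_le E (d : nat -> R) : d n @[n --> \oo] --> (0 : R) ->
  (\forall n \near \oo, prob n (fun A => ~ E n A) <= d n) -> aas q E.
Proof.
move=> d0 le_d; apply: (@aas_ge _ (fun n => 1 - d n)).
  by rewrite -[X in _ --> X]subr0; apply: cvgB d0; exact: cvg_cst.
apply: filterS le_d => n.
by rewrite random_matrix_probE (Pr_not (mx_is_law n)) lerBlDr lerBlDl addrC.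
Qed.

Lemma sub_aas E F :
  (\forall n \near \oo, forall A, E n A -> F n A) -> aas q E -> aas q F.
Proof.
move=> EF /aas_ge; apply; apply: filterS EF => n EF.
exact: (le_Pr (mx_is_law n)) EF.
Qed.

Lemma aas_and E F : aas q E -> aas q F -> aas q (fun n A => E n A /\ F n A).
Proof.
move=> Eq Fq; apply: (@aas_ge _ (fun n => prob n (E n) + prob n (F n) - 1)).
  by rewrite -[X in _ --> X](addrK 1); apply: cvgB (cvg_cst _); exact: cvgD.
apply: nearW => n.
have not_and : prob n (fun A => ~ (E n A /\ F n A))
    <= prob n (fun A => ~ E n A) + prob n (fun A => ~ F n A).
  apply: le_trans (Pr_or_le (mx_is_law n) _ _).
  by apply: (le_Pr (mx_is_law n)) => A /not_andP.
by move: not_and; rewrite !random_matrix_probE !(Pr_not (mx_is_law n)); lra.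
Qed.

Lemma aas_diagonal (E : R -> forall n, 'M[bool]_n.+1 -> Prop) :
  (forall eps, 0 < eps <= 1 -> aas q (E eps)) ->
  exists e : nat -> R, little_o1 e /\ aas q (fun n => E (e n.+1) n).
Proof.
move=> Eq; pose u k : R := harmonic k.
have [k|k [k_large good]] :=
  @near_diagonal (fun k n => 1 - u k <= prob n (E (u k) n)).
  have u01 : 0 < u k <= 1 by rewrite harmonic_gt0 /= invf_le1 // ler1n.
  have /cvgrPdist_le/(_ _ (harmonic_gt0 k)) := Eq _ u01.
  by apply: filterS => n /(le_trans (ler_norm _)); rewrite lerBlDr -lerBlDl.
have uk0 : u (k n) @[n --> \oo] --> (0 : R).
  by apply: cvg_comp (@cvg_harmonic R); apply/cvgnyPge.
exists (fun N => u (k N.-1)); split; first by rewrite /little_o1 -cvg_shiftS.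
apply: aas_ge good; rewrite -[X in _ --> X]subr0.
by apply: cvgB uk0; exact: cvg_cst.
Qed.

(** * Query complexity of random matrices *)

Lemma aas_no_small_set (gamma : nat -> R)
    (bad : forall n, {set 'I_n.+1} -> 'M[bool]_n.+1 -> Prop) (eps : R) :
  (forall N, 2^-1 <= gamma N < 1) ->
  (forall n (S : {set 'I_n.+1}), let mean := n.+1%:R * gamma n.+1 ^+ #|S| in
     1 <= mean -> prob n (bad n S) <= expR 1 * n.+1%:R * expR (- (mean / 8))) ->
  0 < eps <= 1 ->
  aas q (fun n A => forall S : {set 'I_n.+1},
    (#|S| <= lower_threshold gamma eps n)%N -> ~ bad n S A).
Proof.
move=> gamma_itv bad_le eps_itv; have /andP[eps_gt0 _] := eps_itv.
apply: (aas_of_prob_not_le (@cvg_harmonic R)).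
have := near_ln_ge (1 : R); have := near_sqr_ln_le_powR 40 eps_gt0.
apply: filterS2 => n sqr_l_le l_ge1.
apply: le_trans (union_bound_le_harmonic gamma_itv eps_itv l_ge1 sqr_l_le).
set r := lower_threshold _ _ _; set N : R := n.+1%:R in l_ge1 sqr_l_le *.
have n_gt0 : (0 < n)%N by rewrite -(ln_natS_gt0 R) (lt_le_trans ltr01).
have [survivors_ge _] := powR_le_survivors gamma_itv eps_itv n_gt0.
have N_eps_ge1 : 1 <= N `^ eps by rewrite -(powRr0 N) ler_powR ?ler1n // ltW.
apply: (@le_trans _ _
    (prob n (fun A => exists2 S : {set 'I_n.+1}, (#|S| <= r)%N & bad n S A))).
  apply: (le_Pr (mx_is_law n)) => A; apply: contra_notP => none S Sr badS.
  by apply: none; exists S.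
rewrite -[in X in X ^+ r](card_ord n.+1).
apply: (Pr_exists_small_set_le (mx_is_law n)) => [|S Sr].
  by rewrite !mulr_ge0 ?expR_ge0.
have mean_ge : N * gamma n.+1 ^+ r <= N * gamma n.+1 ^+ #|S|.
  have /andP[g_ge /ltW g_lt1] := gamma_itv n.+1.
  by rewrite ler_wpM2l // ler_wiXn2l // (le_trans _ g_ge).
apply: (le_trans (bad_le n S _)).
  by apply: le_trans mean_ge; exact: le_trans survivors_ge.
by rewrite ler_wpM2l ?mulr_ge0 ?expR_ge0 // ler_expR lerN2 ler_pM2r.
Qed.

Lemma prob_few_majority_cols_le n (S : {set 'I_n.+1}) :
  prob n (fun A => (#|constant_cols (majority q n.+1) S A| <= 1)%N)
  <= expR 1 * n.+1%:R * expR (- (n.+1%:R * gs n.+1 ^+ #|S| / 8)).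
Proof.
apply: (le_trans (prob_few_constant_cols_le (q01 n.+1) _ _ _)) => //.
rewrite -gamma_sqcE; have /andP[g_ge g_lt1] := gamma_sqc_itv q01 n.+1.
have g0 : 0 <= gs n.+1 by lra.
set x := gs n.+1 ^+ #|S|.
have x_itv : 0 <= x <= 1 by rewrite exprn_ge0 // exprn_ile1 // ltW.
rewrite [leRHS]mulrAC -expRD [leRHS]mulrC ler_wpM2l //.
apply: (le_trans (onemX_le_expR _ x_itv)); rewrite ler_expR -[n.+1%:R]natr1.
by case/andP: x_itv => x0 x1; have : 0 <= n%:R * x; [rewrite mulr_ge0|lra].
Qed.

Lemma SQC_lower_aas (eps : R) : 0 < eps <= 1 ->
  aas q (fun n A => forall r, SQC A = Some r ->
    lower_rate gs eps n <= r%:R).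
Proof.
move=> eps_itv; apply: (sub_aas _ (aas_no_small_set (gamma_sqc_itv q01)
  (fun n S _ => prob_few_majority_cols_le S) eps_itv)).
apply: nearW => n A many r SQCr; apply: lower_rate_le.
apply: SQC_gt SQCr => S Sr; rewrite ltnNge; apply/negP; exact: many.
Qed.

Lemma QC_lower_aas (eps : R) : 0 < eps <= 1 ->
  aas q (fun n A => forall r, QC A = Some r ->
    lower_rate gq eps n <= r%:R).
Proof.
move=> eps_itv; apply: (sub_aas _ (aas_no_small_set (gamma_qc_itv q01)
  (fun n S => prob_injective_restr_col_le (q01 n.+1) (S := S)) eps_itv)).
apply: nearW => n A ninj r QCr; apply: lower_rate_le.
exact: QC_gt ninj QCr.
Qed.

Lemma equal_cols_aas :
  (\forall n \near \oo, (1 - gs n.+1) * n.+1%:R <= 4^-1 * ln n.+1%:R) ->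
  aas q (fun n A => ~ injective (restr_col A [set: 'I_n.+1]%SET)).
Proof.
move=> small; apply: (aas_of_prob_not_le (@cvg_harmonic R)).
near=> n; have small_n : (1 - gs n.+1) * n.+1%:R <= 4^-1 * ln n.+1%:R by near: n.
have l_ge1 : 1 <= ln n.+1%:R :> R by near: n; exact: near_ln_ge.
have sqr_l_le : 32 * ln n.+1%:R ^+ 2 <= n.+1%:R `^ 2^-1 :> R.
  by near: n; apply: near_sqr_ln_le_powR; rewrite invr_gt0.
set N : R := n.+1%:R in small_n l_ge1 sqr_l_le *.
set l := ln N in small_n l_ge1 sqr_l_le *.
pose majority_cols (A : 'M[bool]_n.+1) :=
  constant_cols (majority q n.+1) [set: 'I_n.+1]%SET A.
apply: (@le_trans _ _ (prob n (fun A => (#|majority_cols A| <= 1)%N))).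
  apply: (le_Pr (mx_is_law n)) => A; apply: contra_notT; rewrite -ltnNge.
  exact: constant_cols_not_injective.
apply: (le_trans (prob_few_majority_cols_le _)); rewrite cardsT card_ord.
have g_itv := gamma_sqc_itv q01 n.+1; rewrite -/N.
have Lg_le : ln (1 / gs n.+1) * N <= 2^-1 * l.
  by have := ler_wpM2r (ler0n R n.+1) (ln_inv_le g_itv); rewrite -/N; lra.
have expR_l : expR l = N by exact: expR_ln_natS.
have N_half_le : N `^ 2^-1 <= N * gs n.+1 ^+ n.+1.
  rewrite -[gs n.+1](expR_Nln_inv g_itv) -expRM_natr powR_natSE -/N -/l.
  by rewrite -[X in _ <= X * _]expR_l -expRD ler_expR; lra.
rewrite /= -/N -[X in _ <= X^-1]expR_l -expRN -[X in expR 1 * X]expR_l -!expRD ler_expR.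
by have : l <= l ^+ 2; [rewrite expr2 ler_peMr // (le_trans ler01)|lra].
Unshelve. all: by end_near. Qed.

Lemma QC_upper_aas (eps : R) : 0 < eps <= 1 ->
  (\forall n \near \oo, 4 * ln n.+1%:R <= (1 - gq n.+1) * n.+1%:R) ->
  aas q (fun n A => exists2 r : nat, QC A = Some r &
    r%:R <= (1 + eps) * query_rate gq n.+1).
Proof.
move=> /andP[eps_gt0 eps_le1] large; apply: (aas_of_prob_not_le (cvg_powRN eps_gt0)).
near=> n; have epsl_ge2 : 2 <= eps * ln n.+1%:R.
  by rewrite mulrC -ler_pdivrMr //; near: n; exact: near_ln_ge.
have gap_ge : 4 * ln n.+1%:R <= (1 - gq n.+1) * n.+1%:R by near: n.
have eps_itv : 0 < eps <= 1 by rewrite eps_gt0.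
have [r [r_le_N r_le power_le]] :=
  exists_separating_size (gamma_qc_itv q01 n.+1) eps_itv epsl_ge2 gap_ge.
apply: le_trans power_le.
have /card_gt0P[S] : (0 < #|[set S : {set 'I_n.+1} | #|S| == r]%SET|)%N.
  by rewrite card_draws card_ord bin_gt0.
rewrite inE => /eqP Sr; rewrite gamma_qc_sqr -Sr.
apply: le_trans (prob_not_injective_restr_col_le (q01 n.+1) S).
apply: (le_Pr (mx_is_law n)) => A; apply: contra_not => /QC_le[m QCm mS].
by exists m => //; apply: le_trans r_le; rewrite ler_nat -Sr.
Unshelve. all: by end_near. Qed.

Lemma distinct_cols_aas :
  (\forall n \near \oo, 8 * ln n.+1%:R <= (1 - gs n.+1) * n.+1%:R) ->
  aas q (fun n A => injective (restr_col A [set: 'I_n.+1]%SET)).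
Proof.
move=> large; apply: (sub_aas _ (QC_upper_aas (eps := 1) _ _)).
- apply: nearW => n A [r QCr _]; apply: contrapT => /QC_undefined.
  by rewrite QCr.
- by rewrite ltr01 lexx.
apply: filterS large => n large_n.
by have := ler_wpM2r (ler0n R n.+1) (onem_gamma_sqc_le_qc q01 n.+1); lra.
Qed.

Definition unbalanced n (eps : R) (D : {set 'I_n.+1}) (A : 'M[bool]_n.+1) : Prop :=
  forall i, exists b, (row_count A D b i)%:R < (1 - eps) * (1 - gs n.+1) * #|D|%:R.

Lemma prob_unbalanced_le n (eps : R) (D : {set 'I_n.+1}) (N := n.+1%:R : R)
    (p := 1 - gs n.+1) : 0 < eps <= 1 -> 8 <= eps ^+ 2 * (p * #|D|%:R) ->
  16 * ln N <= eps ^+ 2 * (p * N) -> prob n (unbalanced eps D) <= (N ^- 2) ^+ #|D|.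
Proof.
move=> eps_itv D_large N_large; have [pq p1q] := onem_gamma_sqc_le q n.+1.
apply: (le_trans (prob_unbalanced_rows_le (q01 n.+1) D eps_itv pq p1q)).
rewrite -/p; set t : R := #|D|%:R in D_large *; set z := eps ^+ 2 / 8 * (p * t).
have two_le : 2 <= expR z.
  by apply: le_trans (expR_ge1Dx z); rewrite /z; lra.
apply: (@le_trans _ _ (expR (- z) ^+ n.+1)).
  apply: lerXn2r; rewrite ?nnegrE ?mulr_ge0 ?expR_ge0 //.
  rewrite (_ : eps ^+ 2 / 4 * p * t = z + z); last by rewrite /z; field.
  rewrite opprD expRD mulrA ler_piMl ?expR_ge0 // expRN.
  by rewrite ler_pdivrMr ?expR_gt0 ?mul1r.
have -> : N ^- 2 = expR (- (2 * ln N)) by rewrite expRN expRM_natl expR_ln_natS.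
rewrite -!expRM_natl ler_expR -/N -/t !mulrN lerN2.
have -> : N * z = t * (eps ^+ 2 * (p * N) / 8) by rewrite /z; field.
by rewrite ler_wpM2l //; lra.
Qed.

Lemma prob_exists_unbalanced_le n (eps : R) (N := n.+1%:R : R) (p := 1 - gs n.+1)
    (K := eps * ln N / p) :
  0 < eps <= 1 -> (0 < n)%N -> 8 / eps ^+ 3 <= ln N -> 16 / eps ^+ 2 * ln N <= p * N ->
  prob n (fun A => exists2 D : {set 'I_n.+1}, K <= #|D|%:R & unbalanced eps D A)
  <= 2 * harmonic n.
Proof.
move=> eps_itv n_gt0 l_ge N_large; have /andP[eps_gt0 _] := eps_itv.
have p_gt0 : 0 < p by exact: onem_gamma_sqc_gt0.
have sqr_eps_gt0 : 0 < eps ^+ 2 by rewrite exprn_gt0.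
have l_gt0 : 0 < ln N by rewrite ln_natS_gt0.
have K_gt0 : 0 < K by rewrite divr_gt0 ?mulr_gt0.
have mean_eq : #|'I_n.+1|%:R * N ^- 2 = N^-1.
  by rewrite card_ord -/N; field; rewrite lt0r_neq0 // ltr0n.
apply: (le_trans (Pr_exists_le (mx_is_law n) _ _)).
apply: (@le_trans _ _ (\sum_(D : {set 'I_n.+1} | D != finset.set0) (N ^- 2) ^+ #|D|)).
  rewrite big_mkcond [leRHS]big_mkcond; apply: ler_sum => D _.
  have [->|D_neq0] := eqVneq D finset.set0; first by rewrite cards0 ifF // leNgt K_gt0.
  case: ifP => [KD|_]; last by rewrite exprn_ge0 // invr_ge0 exprn_ge0.
  apply: prob_unbalanced_le => //; rewrite -/p.
    have D_ge : eps * ln N <= #|D|%:R * p by rewrite -ler_pdivrMr.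
    have := ler_wpM2l (ltW sqr_eps_gt0) D_ge.
    by move: l_ge; rewrite ler_pdivrMr ?exprn_gt0 //; lra.
  by rewrite [leRHS]mulrC -ler_pdivrMr // mulrAC.
rewrite /= -/N -mean_eq sum_nonempty_exp_card_le ?invr_ge0 ?exprn_ge0 //.
by rewrite mean_eq lef_pV2 ?posrE ?ltr0n // ler_nat.
Qed.

Lemma SQC_by_greedy_le n (A : 'M[bool]_n.+1) (eps : R) :
    0 < eps <= 8^-1 -> 1 <= eps * ln n.+1%:R ->
    injective (restr_col A [set: 'I_n.+1]%SET) ->
    (forall D : {set 'I_n.+1},
       eps * ln n.+1%:R / (1 - gs n.+1) <= #|D|%:R -> ~ unbalanced eps D A) ->
  exists2 r : nat, SQC_by greedy A = Some r &
    r%:R <= (1 + 7 * eps) * query_rate gs n.+1.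
Proof.
move=> eps_itv epsl_ge1 injA balanced; have g_itv := gamma_sqc_itv q01 n.+1.
have [J [M [NJ K_lt JM]]] := exists_greedy_phases g_itv eps_itv epsl_ge1.
have idA : identifies greedy A (J + M).
  apply: (greedy_identifies _ _ injA NJ K_lt);
    last move=> D /balanced/existsNP[i /forallNP bal_i].
    have /andP[eps_gt0 eps_le] := eps_itv; have /andP[g_ge g_lt1] := g_itv.
    have : 0 <= (1 - eps) * (1 - gs n.+1) by rewrite mulr_ge0; lra.
    have : 0 <= eps * (1 - gs n.+1) by rewrite mulr_ge0; lra.
    by move=> *; apply/andP; split; lra.
  by exists i => b; rewrite subKr leNgt; apply/negP; exact: bal_i.
have [r SQCr r_le] := minimum_le idA; exists r => //.
by apply: le_trans JM; rewrite ler_nat.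
Qed.

Section LargeGap.
Hypothesis gap_large : much_less (@logN_over_N R) (fun N => 1 - gs N).

Lemma balanced_aas (eps : R) : 0 < eps <= 1 ->
  aas q (fun n A => forall D : {set 'I_n.+1},
    eps * ln n.+1%:R / (1 - gs n.+1) <= #|D|%:R -> ~ unbalanced eps D A).
Proof.
move=> eps_itv; have /andP[eps_gt0 _] := eps_itv.
apply: (@aas_of_prob_not_le _ (fun n => 2 * harmonic n)).
  by rewrite -[X in _ --> X](mulr0 2); apply: cvgZr; exact: cvg_harmonic.
near=> n; apply: le_trans (prob_exists_unbalanced_le (n := n) eps_itv _ _ _).
- apply: (le_Pr (mx_is_law n)) => A.
  by apply: contra_notP => none D KD unb; apply: none; exists D.
- by near: n; exact: nbhs_infty_gt.
- by near: n; exact: near_ln_ge.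
near: n; apply: (near_ge_logN_over_N (h := fun N => 1 - gs N)) => //.
  exact: onem_gamma_sqc_gt0.
by rewrite divr_gt0 ?exprn_gt0.
Unshelve. all: by end_near. Qed.

Lemma SQC_by_greedy_aas (eps : R) : 0 < eps <= 1 ->
  aas q (fun n A => exists2 r : nat, SQC_by greedy A = Some r &
    r%:R <= (1 + eps) * query_rate gs n.+1).
Proof.
move=> /andP[eps_gt0 eps_le1]; pose eta := eps / 8.
have [eta_gt0 eta_le] : 0 < eta /\ eta <= 8^-1 by rewrite /eta; split; lra.
have balanced : aas q (fun n A => forall D : {set 'I_n.+1},
    eta * ln n.+1%:R / (1 - gs n.+1) <= #|D|%:R -> ~ unbalanced eta D A).
  by apply: balanced_aas; rewrite eta_gt0; lra.
have distinct : aas q (fun n A => injective (restr_col A [set: 'I_n.+1]%SET)).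
  apply: distinct_cols_aas; apply: near_ge_logN_over_N gap_large => // N.
  exact: onem_gamma_sqc_gt0.
apply: sub_aas (aas_and balanced distinct).
have := near_ln_ge eta^-1; apply: filterS => n l_ge A [bal injA].
have etal_ge1 : 1 <= eta * ln n.+1%:R by rewrite mulrC -ler_pdivrMr ?div1r.
have [|r SQCr r_le] := SQC_by_greedy_le _ etal_ge1 injA bal; first by rewrite eta_gt0.
exists r => //; apply: (le_trans r_le).
rewrite ler_wpM2r //; last by rewrite /eta; lra.
apply: divr_ge0; first by rewrite ln_ge0 ?ler1n.
by rewrite ltW // ln_inv_gt0 // gamma_sqc_itv.
Qed.

Lemma SQC_by_greedy_rate : exists e : nat -> R, little_o1 e /\
  aas q (fun n A => exists2 r : nat, SQC_by greedy A = Some r &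
    r%:R <= (1 + e n.+1) * query_rate gs n.+1).
Proof. exact: (aas_diagonal SQC_by_greedy_aas). Qed.

Lemma SQCP_rate : exists e : nat -> R, little_o1 e /\
  aas q (fun n A => exists2 r : nat, SQCP A = Some r &
    r%:R <= (1 + e n.+1) * query_rate gs n.+1).
Proof.
have [e [e_o1 rate]] := SQC_by_greedy_rate; exists e; split=> //.
apply: sub_aas rate; apply: nearW => n A [r].
move=> /(SQCP_le_SQC_by greedy_polynomial_time)[m SQCPm mr] r_le; exists m => //.
by apply: le_trans r_le; rewrite ler_nat.
Qed.

Lemma SQC_rate : exists e : nat -> R, little_o1 e /\
  aas q (fun n A => exists2 r : nat, SQC A = Some r & lower_rate gs (e n.+1) n <= r%:R).
Proof.
have [greedy_e [_ upper]] := SQC_by_greedy_rate.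
have [e [e_o1 lower]] := aas_diagonal SQC_lower_aas.
exists e; split=> //; apply: sub_aas (aas_and lower upper).
apply: nearW => n A [lowerA [r /SQC_le_SQC_by[m SQCm _] _]].
by exists m => //; exact: lowerA.
Qed.

End LargeGap.

Lemma QC_rate : much_less (@logN_over_N R) (fun N => 1 - gq N) ->
  exists e1 e2 : nat -> R, [/\ little_o1 e1, little_o1 e2 &
    aas q (fun n A => exists2 r : nat, QC A = Some r &
      lower_rate gq (e1 n.+1) n <= r%:R <= (1 + e2 n.+1) * query_rate gq n.+1)].
Proof.
move=> gap_large.
have gap_ge := near_ge_logN_over_N (onem_gamma_qc_gt0 q01) (ltr0n R 4) gap_large.
have [e1 [e1_o1 lower]] := aas_diagonal QC_lower_aas.
have [e2 [e2_o1 upper]] :=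
  aas_diagonal (fun eps eps_itv => QC_upper_aas eps_itv gap_ge).
exists e1, e2; split=> //; apply: sub_aas (aas_and lower upper).
by apply: nearW => n A [lowerA [r QCr r_le]]; exists r; rewrite // lowerA.
Qed.

End RandomMatrixAsymptotics.

Theorem theorem3 (R : realType) (q : nat -> R) (hq : forall N, 0 < q N < 1) :
  let gs := gamma_sqc q in
  let gq := gamma_qc q in
  [/\ (* (i) *)
      (forall N, 1 - gs N <= 1) ->
      much_less (@logN_over_N R) (fun N => 1 - gs N) ->
      [/\ exists e : nat -> R, little_o1 e /\
            aas q (fun n A => exists2 r : nat, SQC A = Some r &
              (eta_exp gs n.+1 - e n.+1) * query_rate gs n.+1 <= r%:R),
          exists e : nat -> R, little_o1 e /\
            aas q (fun n A => exists2 r : nat, SQCP A = Some r &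
              r%:R <= (1 + e n.+1) * query_rate gs n.+1)
        & exists g : strategy, polynomial_time g /\
            exists e : nat -> R, little_o1 e /\
            aas q (fun n A => exists2 r : nat, SQC_by g A = Some r &
              r%:R <= (1 + e n.+1) * query_rate gs n.+1)],
      (* (ii) *)
      much_less (fun N => 1 - gs N) (@logN_over_N R) ->
      aas q (fun n A => SQC A = None),
      (* (i) for QC *)
      much_less (@logN_over_N R) (fun N => 1 - gq N) ->
      exists e1 e2 : nat -> R, [/\ little_o1 e1, little_o1 e2 &
        aas q (fun n A => exists2 r : nat, QC A = Some r &
          (eta_exp gq n.+1 - e1 n.+1) * query_rate gq n.+1 <= r%:R
            <= (1 + e2 n.+1) * query_rate gq n.+1)]
    & (* (ii) for QC *)
      much_less (fun N => 1 - gq N) (@logN_over_N R) ->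
      aas q (fun n A => QC A = None)].
Proof.
split=> [_ large|small|large|small].
- split; [exact: SQC_rate|exact: SQCP_rate|].
  by exists greedy; split; [exact: greedy_polynomial_time|exact: SQC_by_greedy_rate].
- apply: (sub_aas hq) (equal_cols_aas hq _).
    by apply: nearW => n A; exact: SQC_undefined.
  by apply: near_le_logN_over_N small; rewrite invr_gt0.
- exact: QC_rate.
- apply: (sub_aas hq) (equal_cols_aas hq _).
    by apply: nearW => n A; exact: QC_undefined.
  have eighth_gt0 : 0 < 8^-1 :> R by rewrite invr_gt0.
  apply: filterS (near_le_logN_over_N eighth_gt0 small) => n small_n.
  by have := ler_wpM2r (ler0n R n.+1) (onem_gamma_sqc_le_qc hq n.+1); lra.
Qed.
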